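(* Set all $m_x=m$ for $x\in\mathcal G-\partial\mathcal G$. Let $\mathfrak s_t$ evolve as the open SEP$(m/2)$ on $\mathcal G-\partial\mathcal G$ with particle reservoirs at $\partial\mathcal G$ (parameters $\alpha_y$, $y\in\partial\mathcal G$), and let $\mathfrak s'_t$ evolve as the SEP$(\vec m)$ on $\mathcal G$ with finitely many particles, in which the sites of $\partial\mathcal G$ are sinks. Then $\mathfrak s_t$ and $\mathfrak s'_t$ are dual with respect to the function $$D(\mathfrak s,\mathfrak s')=\prod_{y\in\partial\mathcal G}\alpha_y^{\mathfrak s'(y)}\prod_{x\in\mathcal G-\partial\mathcal G}\frac{\binom{\mathfrak s(x)}{\mathfrak s'(x)}}{\binom m{\mathfrak s'(x)}}1_{\{\mathfrak s(x)\ge\mathfrak s'(x)\}}.$$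
   Context: $\mathcal G$ is (the vertex set of) a complete graph, $p$ is a symmetric stochastic matrix on $\mathcal G$, and $\partial\mathcal G\subset\mathcal G$ is a subset. For each $y\in\partial\mathcal G$ a parameter $\alpha_y\in[0,1]$ is given. *Process $\mathfrak s_t$* (open SEP$(m/2)$): a configuration assigns to each $x\in\mathcal G-\partial\mathcal G$ a number $\mathfrak s(x)\in\{0,\dots,m\}$. For $x,x'\in\mathcal G-\partial\mathcal G$, a particle jumps from $x$ to $x'$ at rate $p(x,x')\frac{\mathfrak s(x)}m\frac{m-\mathfrak s(x')}m$. For $x\in\mathcal G-\partial\mathcal G$ and $y\in\partial\mathcal G$, a particle at $x$ exits to the reservoir $y$ at rate $p(x,y)(1-\alpha_y)\frac{\mathfrak s(x)}m$, and a particle enters $x$ from the reservoir $y$ at rate $p(y,x)\alpha_y\frac{m-\mathfrak s(x)}m$. *Process $\mathfrak s'_t$*: a configuration assigns to each $x\in\mathcal G-\partial\mathcal G$ a number $\mathfrak s'(x)\in\{0,\dots,m\}$ and to each $y\in\partial\mathcal G$ a number $\mathfrak s'(y)\in\{0,1,2,\dots\}$, with finitely many particles in total. Particles jump between sites $x,x'$ of $\mathcal G-\partial\mathcal G$ at rate $p(x,x')\frac{\mathfrak s'(x)}m\frac{m-\mathfrak s'(x')}m$, and from $x\in\mathcal G-\partial\mathcal G$ to $y\in\partial\mathcal G$ at rate $p(x,y)\frac{\mathfrak s'(x)}m$; particles in $\partial\mathcal G$ never leave. Processes $X(t)$ on $\mathfrak X$ and $Y(t)$ on $\mathfrak Y$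 are dual with respect to $D$ if $\mathbb E_x[D(X(t),y)]=\mathbb E_y[D(x,Y(t))]$ for all $x\in\mathfrak X$, $y\in\mathfrak Y$, $t\ge0$. *)

(* Defs.v *)
From HB Require Import structures.
From mathcomp Require Import all_boot all_order all_algebra finmap.
From mathcomp Require Import all_classical all_reals all_analysis.
From mathcomp Require Import measurable_realfun.

Set Implicit Arguments.
Unset Strict Implicit.
Unset Printing Implicit Defensive.

Import Order.TTheory GRing.Theory Num.Theory.
Import numFieldNormedType.Exports.

Local Open Scope classical_set_scope.
Local Open Scope ring_scope.

(* Sum of an absolutely summable real family, as the difference of the sums of
   its positive and negative parts. *)
Definition rsum (R : realType) (I : choiceType) (F : I -> R) : R :=
  fine (\esum_(i in [set: I]) (EFin \o F)^\+ i)%E -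
  fine (\esum_(i in [set: I]) (EFin \o F)^\- i)%E.

Definition symmetric_stochastic (R : realType) (G : countType)
    (p : G -> G -> R) : Prop :=
  [/\ forall x y, 0 <= p x y,
      forall x, (\esum_(y in [set: G]) (p x y)%:E = 1)%E &
      forall x y, p x y = p y x].

(* Time ranges over the nonnegative reals; the values of X at negative times
   are never used. [P x] is the law under which X is started from x. *)
Definition natural_filtration (R : realType) (dO d : measure_display)
    (Omega : measurableType dO) (E : measurableType d)
    (X : R -> Omega -> E) (t : R) : set (set Omega) :=
  <<s [set A | exists (u : R) U,
         [/\ 0 <= u <= t, measurable U & A = X u @^-1` U] ] >>.

Record markov_process (R : realType) (dO d : measure_display)
    (Omega : measurableType dO) (E : measurableType d)
    (P : E -> probability Omega R) (X : R -> Omega -> E) : Prop := {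
  markov_measurable : forall t : R, 0 <= t -> measurable_fun setT (X t) ;
  markov_start : forall x, {ae P x, forall w, X 0 w = x} ;
  markov_transition_measurable : forall (t : R) (U : set E), 0 <= t ->
    measurable U -> measurable_fun setT (fun x => P x (X t @^-1` U)) ;
  markov_property : forall x (t h : R) (U : set E) (A : set Omega),
    0 <= t -> 0 <= h -> measurable U -> natural_filtration X t A ->
    P x (A `&` X (t + h) @^-1` U) =
      (\int[P x]_(w in A) P (X t w) (X h @^-1` U))%E }.

Definition semigroup (R : realType) (dO : measure_display)
    (Omega : measurableType dO) (E : Type)
    (P : E -> probability Omega R) (X : R -> Omega -> E)
    (t : R) (f : E -> R) (x : E) : R :=
  fine ('E_(P x)[f \o X t])%E.

Definition dual_wrt (R : realType) (dO dO' : measure_display)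
    (Omega : measurableType dO) (Omega' : measurableType dO') (E E' : Type)
    (P : E -> probability Omega R) (X : R -> Omega -> E)
    (P' : E' -> probability Omega' R) (Y : R -> Omega' -> E')
    (D : E -> E' -> R) : Prop :=
  forall (x : E) (y : E') (t : R), 0 <= t ->
    ('E_(P x)[fun w => D (X t w) y] = 'E_(P' y)[fun w => D x (Y t w)])%E.

Definition bulk (G : countType) (B : {pred G}) : Type := {x : G | x \notin B}.
Definition bdry (G : countType) (B : {pred G}) : Type := {y : G | y \in B}.
HB.instance Definition _ (G : countType) (B : {pred G}) :=
  Countable.copy (bulk B) {x : G | x \notin B}.
HB.instance Definition _ (G : countType) (B : {pred G}) :=
  Countable.copy (bdry B) {y : G | y \in B}.

HB.instance Definition _ (m : nat) := isPointed.Build 'I_m.+1 ord0.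

Definition open_config (G : countType) (B : {pred G}) (m : nat) : Type :=
  bulk B -> 'I_m.+1.
HB.instance Definition _ (G : countType) (B : {pred G}) (m : nat) :=
  Pointed.copy (open_config B m) (bulk B -> 'I_m.+1).

(* Generators of the product sigma-algebra. *)
Definition coordinate_events (G : countType) (B : {pred G}) (m : nat) :
    set (set (open_config B m)) :=
  [set A | exists x k, A = [set s | s x = k]].

Definition open_space (G : countType) (B : {pred G}) (m : nat) :=
  g_sigma_algebraType (@coordinate_events G B m).

(* Finitely many particles: both components are finitely supported. *)
Definition sink_config (G : countType) (B : {pred G}) (m : nat) : Type :=
  ({fsfun bulk B -> 'I_m.+1 with ord0} * {fsfun bdry B -> nat with 0%N})%type.
HB.instance Definition _ (G : countType) (B : {pred G}) (m : nat) :=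
  Choice.copy (sink_config B m)
    ({fsfun bulk B -> 'I_m.+1 with ord0} * {fsfun bdry B -> nat with 0%N})%type.
HB.instance Definition _ (G : countType) (B : {pred G}) (m : nat) :=
  isPointed.Build (sink_config B m)
    ([fsfun with ord0], [fsfun with 0%N]).

(* The state space is countable and discrete. *)
Definition sink_space (G : countType) (B : {pred G}) (m : nat) :=
  g_sigma_algebraType [set: set (sink_config B m)].

(* [inord] returns 0 out of range; all moves that would leave 'I_m.+1 have
   rate 0. A jump from x to x itself (p x x may be positive) leaves the
   configuration unchanged. *)
Section OpenSEP.
Variables (R : realType) (G : countType) (p : G -> G -> R) (B : {pred G}).
Variables (m : nat) (alpha : bdry B -> R).
Implicit Types (s : open_config B m) (f : open_config B m -> R).

Definition open_remove s (x : bulk B) : open_config B m :=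
  fun z => if z == x then inord (s z).-1 else s z.

Definition open_add s (x : bulk B) : open_config B m :=
  fun z => if z == x then inord (s z).+1 else s z.

Definition open_generator f s : R :=
  rsum (fun e : bulk B * bulk B => let: (x, x') := e in
    p (val x) (val x') * ((s x)%:R / m%:R) * ((m - s x')%:R / m%:R) *
    (f (open_add (open_remove s x) x') - f s)) +
  rsum (fun e : bulk B * bdry B => let: (x, y) := e in
    p (val x) (val y) * (1 - alpha y) * ((s x)%:R / m%:R) *
    (f (open_remove s x) - f s)) +
  rsum (fun e : bulk B * bdry B => let: (x, y) := e in
    p (val y) (val x) * alpha y * ((m - s x)%:R / m%:R) *
    (f (open_add s x) - f s)).

Definition cylinder f : Prop :=
  exists A : seq (bulk B), forall s1 s2, {in A, s1 =1 s2} -> f s1 = f s2.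

(* Interacting particle systems convention: the generator, in the sup norm,
   acts on functions of finitely many sites by the given rates. For finite G
   every function is of this kind and this says that the Q-matrix of the
   process consists of the given rates. *)
Definition is_open_SEP (dO : measure_display) (Omega : measurableType dO)
    (P : open_space B m -> probability Omega R)
    (X : R -> Omega -> open_space B m) : Prop :=
  markov_process P X /\
  forall f, cylinder f -> forall e : R, 0 < e ->
    \forall h \near 0^'+, forall s,
      `| (semigroup P X h f s - f s) / h - open_generator f s | <= e.

End OpenSEP.

Section SinkSEP.
Variables (R : realType) (G : countType) (p : G -> G -> R) (B : {pred G}).
Variable (m : nat).
Implicit Types (s : sink_config B m) (f : sink_config B m -> R).

Definition sink_remove s (x : bulk B) : sink_config B m :=
  ([fsfun s.1 with x |-> inord (s.1 x).-1], s.2).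

Definition sink_add s (x : bulk B) : sink_config B m :=
  ([fsfun s.1 with x |-> inord (s.1 x).+1], s.2).

Definition sink_absorb s (y : bdry B) : sink_config B m :=
  (s.1, [fsfun s.2 with y |-> (s.2 y).+1]).

Definition sink_generator f s : R :=
  rsum (fun e : bulk B * bulk B => let: (x, x') := e in
    p (val x) (val x') * ((s.1 x)%:R / m%:R) * ((m - s.1 x')%:R / m%:R) *
    (f (sink_add (sink_remove s x) x') - f s)) +
  rsum (fun e : bulk B * bdry B => let: (x, y) := e in
    p (val x) (val y) * ((s.1 x)%:R / m%:R) *
    (f (sink_absorb (sink_remove s x) y) - f s)).

(* Continuous-time Markov chain on a countable space: the transition function
   has derivative at time 0 equal to the Q-matrix, whose (s, s1) entry is the
   generator applied to the indicator function of s1. *)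
Definition is_sink_SEP (dO : measure_display) (Omega : measurableType dO)
    (P : sink_space B m -> probability Omega R)
    (X : R -> Omega -> sink_space B m) : Prop :=
  markov_process P X /\
  forall s s1 : sink_config B m, let f := \1_[set s1] : sink_config B m -> R in
    (semigroup P X h f s - f s) / h @[h --> 0^'+] --> sink_generator f s.

End SinkSEP.

(* The products have finitely many factors different from 1, since s' is
   finitely supported. *)
Definition duality_fun (R : realType) (G : countType) (B : {pred G}) (m : nat)
    (alpha : bdry B -> R) (s : open_config B m) (s' : sink_config B m) : R :=
  \big[*%R/1]_(y \in [set: bdry B]) (alpha y ^+ s'.2 y) *
  \big[*%R/1]_(x \in [set: bulk B])
    ('C(s x, s'.1 x)%:R / 'C(m, s'.1 x)%:R * (s'.1 x <= s x)%N%:R : R).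

(* Main.v *)
From HB Require Import structures.
Require Import Defs.
From mathcomp Require Import all_boot all_order all_algebra finmap.
From mathcomp Require Import all_classical all_reals all_analysis.
From mathcomp Require Import measurable_realfun ring lra.

(** For a sink configuration h let u_h(t) = E_s[D(s_t, h)] and
    v_h(t) = E_h[D(s, s'_t)]. The algebraic core is the identity of generators
    L D(., h) (s) = L' D(s, .) (h), checked edge by edge after symmetrizing over
    the two orientations of a bulk edge; p being symmetric is what allows it.
    By Chapman-Kolmogorov both u and v then solve, uniformly in t, the backward
    equation w_h'(t+) = L' w_.(t) (h). For v this needs the difference
    quotients of the sink semigroup to converge uniformly over test functions
    bounded by 1, which follows from entrywise convergence because L' kills
    constants (Scheffe's argument). A configuration with at most N bulk
    particles only jumps to configurations of the same kind, at total rate at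
    most 2N, so the equation for w = u - v restricted to them is driven by a
    bounded operator, and w = 0 since w(0) = 0.

    Infinite sums over edges are replaced throughout by finite lists of jumps
    that approximate L' uniformly over test functions bounded by 1, so no
    interchange of expectation and infinite sum is needed. *)

Set Implicit Arguments.
Unset Strict Implicit.
Unset Printing Implicit Defensive.

Import Order.TTheory GRing.Theory Num.Theory.
Import numFieldNormedType.Exports.

Local Open Scope classical_set_scope.
Local Open Scope ring_scope.

(** * Semigroup of a Markov process *)

Section MarkovSemigroup.
Context (R : realType) (dO d : measure_display).
Context (Omega : measurableType dO) (E : measurableType d).
Variables (P : E -> probability Omega R) (X : R -> Omega -> E).
Hypothesis PX : markov_process P X.
Implicit Types (f g : E -> R) (x : E) (t h M : R).

Lemma semigroupE t f x : semigroup P X t f x = \int[P x]_w f (X t w).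
Proof. by rewrite /semigroup unlock. Qed.

Lemma markov_integrable t f M x : 0 <= t -> measurable_fun setT f ->
  (forall z, `|f z| <= M) ->
  (P x).-integrable setT (EFin \o (fun w => f (X t w))).
Proof.
move=> t0 mf fM; apply: measurable_bounded_integrable => //.
- by rewrite (le_lt_trans (probability_le1 _ _))// ltry.
- by apply: (measurableT_comp mf); exact: (markov_measurable PX).
- exists M; split; first exact: num_real.
  by move=> r Mr w _ /=; rewrite (le_trans (fM _))// ltW.
Qed.

Lemma semigroupD t f g M N x : 0 <= t ->
  measurable_fun setT f -> (forall z, `|f z| <= M) ->
  measurable_fun setT g -> (forall z, `|g z| <= N) ->
  semigroup P X t (fun z => f z + g z) x =
  semigroup P X t f x + semigroup P X t g x.
Proof.
move=> t0 mf fM mg gN; rewrite !semigroupE RintegralD//.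
  exact: markov_integrable fM.
exact: markov_integrable gN.
Qed.

Lemma semigroupZ t f M c x : 0 <= t ->
  measurable_fun setT f -> (forall z, `|f z| <= M) ->
  semigroup P X t (fun z => c * f z) x = c * semigroup P X t f x.
Proof.
move=> t0 mf fM; rewrite !semigroupE RintegralZl//.
exact: markov_integrable fM.
Qed.

Lemma semigroup_cst t c x : semigroup P X t (fun=> c) x = c.
Proof.
by rewrite semigroupE Rintegral_cst//= [X in fine X]probability_setT mulr1.
Qed.

Lemma le_semigroup t f g M N x : 0 <= t ->
  measurable_fun setT f -> (forall z, `|f z| <= M) ->
  measurable_fun setT g -> (forall z, `|g z| <= N) ->
  (forall z, f z <= g z) ->
  semigroup P X t f x <= semigroup P X t g x.
Proof.
move=> t0 mf fM mg gN fg; rewrite !semigroupE le_Rintegral//.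
  exact: markov_integrable fM.
exact: markov_integrable gN.
Qed.

Lemma semigroupN t f M x : 0 <= t ->
  measurable_fun setT f -> (forall z, `|f z| <= M) ->
  semigroup P X t (fun z => - f z) x = - semigroup P X t f x.
Proof.
move=> t0 mf fM; rewrite -mulN1r -(semigroupZ (-1) x t0 mf fM).
by congr semigroup; apply/funext => z; rewrite mulN1r.
Qed.

Lemma semigroupB t f g M N x : 0 <= t ->
  measurable_fun setT f -> (forall z, `|f z| <= M) ->
  measurable_fun setT g -> (forall z, `|g z| <= N) ->
  semigroup P X t (fun z => f z - g z) x =
  semigroup P X t f x - semigroup P X t g x.
Proof.
move=> t0 mf fM mg gN.
rewrite (@semigroupD t f (fun z => - g z) M N)//.
- by rewrite (semigroupN x t0 mg gN).
- exact: measurableT_comp.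
- by move=> z; rewrite normrN.
Qed.

Lemma normr_semigroup_le t f g M x : 0 <= t ->
  measurable_fun setT f -> measurable_fun setT g -> (forall z, g z <= M) ->
  (forall z, `|f z| <= g z) ->
  `|semigroup P X t f x| <= semigroup P X t g x.
Proof.
move=> t0 mf mg gM fg.
have fM z : `|f z| <= M := le_trans (fg z) (gM z).
have gM' z : `|g z| <= M.
  by rewrite ger0_norm// (le_trans (normr_ge0 _) (fg z)).
rewrite ler_norml -(semigroupN x t0 mg gM'); apply/andP; split.
  apply: (@le_semigroup t (fun z => - g z) f M M x) => //.
  - exact: measurableT_comp.
  - by move=> z; rewrite normrN.
  - by move=> z; move: (fg z); rewrite ler_norml => /andP[].
apply: (@le_semigroup t f g M M x) => // z.
exact: le_trans (ler_norm _) (fg z).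
Qed.

Lemma normr_semigroup_le_cst t f M x : 0 <= t ->
  measurable_fun setT f -> (forall z, `|f z| <= M) ->
  `|semigroup P X t f x| <= M.
Proof.
move=> t0 mf fM; rewrite -[leRHS](semigroup_cst t M x).
exact: (@normr_semigroup_le t f (fun=> M) M x).
Qed.

Lemma semigroup_sum t (I : eqType) (r : seq I) (F : I -> E -> R)
    (M : I -> R) x : 0 <= t ->
  (forall i, measurable_fun setT (F i)) ->
  (forall i z, `|F i z| <= M i) ->
  semigroup P X t (fun z => \sum_(i <- r) F i z) x =
  \sum_(i <- r) semigroup P X t (F i) x.
Proof.
move=> t0 mF FM; elim: r => [|i r ih].
  rewrite big_nil -[RHS](semigroup_cst t 0 x); congr semigroup.
  by apply/funext => z; rewrite big_nil.
rewrite big_cons -ih.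
under [in LHS]eq_fun do rewrite big_cons.
apply: (semigroupD x t0 (mF i) (FM i)); first exact: measurable_sum.
move=> z; rewrite (le_trans (ler_norm_sum _ _ _))//.
by apply: ler_sum => j _; exact: FM.
Qed.

Lemma semigroup0 f x : measurable_fun setT f -> semigroup P X 0 f x = f x.
Proof.
move=> mf; rewrite -[RHS](semigroup_cst 0 (f x) x) !semigroupE; congr fine.
apply: ae_eq_integral => //.
- apply/measurable_EFinP; apply: (measurableT_comp mf).
  exact: (markov_measurable PX).
- by apply: filterS (markov_start PX x) => w Xw _ /=; rewrite Xw.
Qed.

Section law.
Variables (t : R) (t0 : 0 <= t).

Let Xt : {mfun Omega >-> E} := mfun_Sub (mem_set (markov_measurable PX t0)).

Let law x : {measure set E -> \bar R} := distribution (P x) Xt.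

Let measurable_law U : measurable U -> measurable_fun setT (law ^~ U).
Proof. by move=> mU; exact: (markov_transition_measurable PX). Qed.

(** By [markov_transition_measurable] the law of [X t] under [P x] is a kernel in [x], and
    integrating a nonnegative measurable function against a kernel gives a measurable function of
    [x]. *)
Lemma measurable_markov_integral (f : E -> \bar R) :
  measurable_fun setT f -> (forall z, 0 <= f z)%E ->
  measurable_fun setT (fun x => \int[P x]_w f (X t w))%E.
Proof.
move=> mf f0.
rewrite (_ : (fun x => _) = (fun x => \int[law x]_z f z)%E).
  exact: measurable_fun_integral_kernel measurable_law _ f0 mf.
by apply/funext => x; rewrite ge0_integral_distribution.
Qed.

End law.

Lemma measurable_semigroup t f : 0 <= t -> measurable_fun setT f ->
  (forall z, 0 <= f z) -> measurable_fun setT (semigroup P X t f).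
Proof.
move=> t0 mf f0.
have -> : semigroup P X t f = (fun x => \int[P x]_w f (X t w)).
  by apply/funext => x; rewrite semigroupE.
apply: measurableT_comp => //.
apply: (@measurable_markov_integral t t0 (EFin \o f)) => //.
exact/measurable_EFinP.
Qed.

(** * The Chapman-Kolmogorov equation *)

Section composition.
Variables (t h : R) (t0 : 0 <= t) (h0 : 0 <= h).

Let th0 : 0 <= t + h := addr_ge0 t0 h0.

Let path u (u0 : 0 <= u) : {mfun Omega >-> E} :=
  mfun_Sub (mem_set (markov_measurable PX u0)).

Let law u (u0 : 0 <= u) x : {measure set E -> \bar R} :=
  distribution (P x) (path u0).

(** Kernel composition takes a kernel from a space [S] and a kernel from [S * E]. Taking [S] to be
    [unit] casts the law at time [t] as the first kernel; the second, [step], ignores its [unit]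
    component. *)
Let source x (_ : unit) := law t0 x.

Let measurable_source x U :
  measurable U -> measurable_fun setT (source x ^~ U).
Proof. by []. Qed.

HB.instance Definition _ x :=
  isKernel.Build _ _ unit E R (source x) (@measurable_source x).

Let source1 x u : source x u setT = 1%E.
Proof. exact: probability_setT. Qed.

HB.instance Definition _ x :=
  Kernel_isProbability.Build _ _ unit E R (source x) (source1 x).

Let step (z : unit * E) := law h0 z.2.

Let measurable_step U : measurable U -> measurable_fun setT (step ^~ U).
Proof.
move=> mU; apply: (measurableT_comp (f := fun z => law h0 z U) (g := snd)).
  exact: (markov_transition_measurable PX).
exact: measurable_snd.
Qed.

HB.instance Definition _ :=
  isKernel.Build _ _ (unit * E)%type E R step measurable_step.

Let step1 z : step z setT = 1%E.
Proof. exact: probability_setT. Qed.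

HB.instance Definition _ :=
  Kernel_isProbability.Build _ _ (unit * E)%type E R step step1.

(** On a measurable set this is the Markov property conditioned on the sure event, so the law at
    time [t + h] equals the composed kernel. Equality of measures then carries over to nonnegative
    integrands. *)
Lemma markov_integral_comp (f : E -> \bar R) x :
  measurable_fun setT f -> (forall z, 0 <= f z)%E ->
  (\int[P x]_w f (X (t + h) w) =
   \int[P x]_w \int[P (X t w)]_w' f (X h w'))%E.
Proof.
move=> mf f0.
transitivity (\int[law th0 x]_z f z)%E.
  by rewrite ge0_integral_distribution.
transitivity (\int[kcomp (source x) step tt]_z f z)%E.
  apply: eq_measure_integral => U mU _.
  transitivity (\int[law t0 x]_z law h0 z U)%E; last by [].
  rewrite ge0_integral_distribution//; last first.
    exact: (markov_transition_measurable PX).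
  transitivity (P x (setT `&` X (t + h) @^-1` U)); first by rewrite setTI.
  apply: (markov_property PX) => //.
  (* The sure event belongs to the filtration as the complement of the empty set. *)
  rewrite -setC0; apply: sigma_algebraC; exact: sigma_algebra0.
rewrite integral_kcomp//.
transitivity (\int[law t0 x]_z \int[P z]_w f (X h w))%E.
  by apply: eq_integral => z _; exact: (ge0_integral_distribution _ mf f0).
rewrite ge0_integral_distribution//.
- exact: measurable_markov_integral.
- by move=> z; apply: integral_ge0.
Qed.

(** Nonnegativity allows [markov_integral_comp]; the bound makes the inner expectation finite, so
    that the [fine] inside [semigroup] loses nothing. *)
Lemma semigroup_add f M x : measurable_fun setT f ->
  (forall z, 0 <= f z <= M) ->
  semigroup P X (t + h) f x = semigroup P X t (semigroup P X h f) x.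
Proof.
move=> mf fM; rewrite !semigroupE; congr fine.
have f0 z : 0 <= f z by case/andP: (fM z).
rewrite (@markov_integral_comp (EFin \o f) x); last 2 first.
- exact/measurable_EFinP.
- by move=> z; rewrite lee_fin.
apply: eq_integral => w _; rewrite semigroupE fineK//.
apply: integrable_fin_num => //; apply: (@markov_integrable _ _ M) => // z.
by case/andP: (fM z) => ? ?; rewrite ger0_norm.
Qed.

End composition.

End MarkovSemigroup.

(** * Uniqueness for the backward equation *)

(** The generator at [y] of a pure jump process, where [J] lists finitely many pairs of a rate and a
    target. *)
Definition jump_part (R : realType) (T : Type) (J : seq (R * T)) (g : T -> R)
  (y : T) : R := \sum_(j <- J) j.1 * (g j.2 - g y).

Section JumpEquation.
Context (R : realType) (T : choiceType).
Implicit Types (C : set T) (J : seq (R * T)) (g : T -> R) (w : T -> R -> R).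

(** All targets stay in [C], so an equation driven by such jumps closes on [C]; the total rate [K]
    bounds the operator in sup norm there. *)
Definition rated_jumps C (K : R) J :=
  (forall j, j \in J -> 0 <= j.1 /\ C j.2) /\ \sum_(j <- J) j.1 <= K.

Lemma le_rated_jumps C K K' J : K <= K' -> rated_jumps C K J ->
  rated_jumps C K' J.
Proof. by move=> KK' [CJ JK]; split => //; exact: le_trans KK'. Qed.

Lemma norm_jump_part_le C K J g M y : rated_jumps C K J -> C y ->
  (forall z, C z -> `|g z| <= M) -> `|jump_part J g y| <= K * (M + M).
Proof.
move=> [CJ JK] Cy gM.
have M0 : 0 <= M := le_trans (normr_ge0 _) (gM _ Cy).
rewrite (le_trans (ler_norm_sum _ _ _))//.
apply: (@le_trans _ _ ((\sum_(j <- J) j.1) * (M + M))); last first.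
  by apply: ler_wpM2r => //; rewrite addr_ge0.
rewrite mulr_suml !big_seq; apply: ler_sum => j /CJ[j0 Cj].
rewrite normrM (ger0_norm j0) ler_wpM2l// (le_trans (ler_normB _ _))//.
by rewrite lerD// gM.
Qed.

(** A mean value inequality: the interval is cut into equal steps shorter than [d] and the
    increments are added. As [d] is the same at every time, neither continuity nor compactness
    enters. *)
Lemma norm_increment_le (u : R -> R) (c d a t : R) : 0 < d -> a <= t ->
  (forall r h, a <= r -> r + h <= t -> 0 < h < d ->
    `|u (r + h) - u r| <= h * c) ->
  `|u t - u a| <= (t - a) * c.
Proof.
move=> d0; rewrite le_eqVlt => /predU1P[-> _|at_ uc].
  by rewrite !subrr normr0 mul0r.
have ta0 : 0 < t - a by rewrite subr_gt0.
pose n := Num.Def.archi_bound ((t - a) / d).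
have n_gt : (t - a) / d < n.+1%:R.
  rewrite (lt_le_trans (archi_boundP _))//; first by rewrite divr_ge0 ?ltW.
  by rewrite ler_nat.
pose h := (t - a) / n.+1%:R.
have h0 : 0 < h by rewrite divr_gt0.
have hd : h < d by rewrite ltr_pdivrMr// mulrC -ltr_pdivrMr.
have nh : n.+1%:R * h = t - a by rewrite mulrC divfK// pnatr_eq0.
suff H k : (k <= n.+1)%N -> `|u (a + k%:R * h) - u a| <= k%:R * h * c.
  by have := H n.+1 (leqnn _); rewrite nh (addrC a) subrK.
elim: k => [_|k ih kn]; first by rewrite !mul0r addr0 subrr normr0.
have -> : a + k.+1%:R * h = a + k%:R * h + h by rewrite -natr1; ring.
have -> : k.+1%:R * h * c = h * c + k%:R * h * c by rewrite -natr1; ring.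
rewrite -(subrKA (u (a + k%:R * h))) (le_trans (ler_normD _ _))// lerD//.
  apply: uc; rewrite ?h0//; first by rewrite lerDl mulr_ge0// ltW.
  have : k.+1%:R * h <= n.+1%:R * h by rewrite ler_wpM2r ?ler_nat// ltW.
  by rewrite nh -natr1; lra.
exact/ih/ltnW.
Qed.

Lemma norm_le_geometric_eq0 (x M : R) :
  (forall k, `|x| <= M / 2 ^+ k) -> x = 0.
Proof.
move=> xM; apply/eqP; apply: contraT => x0.
have nx0 : 0 < `|x| by rewrite normr_gt0.
have M0 : 0 <= M by have := xM 0; rewrite expr0 divr1; apply: le_trans.
pose k := Num.Def.archi_bound (M / `|x|).
have Mk : M / `|x| < k%:R by rewrite archi_boundP// divr_ge0.
have k2 : k%:R <= 2 ^+ k :> R by rewrite -natrX ler_nat ltnW// ltn_expl.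
have := xM k; rewrite ler_pdivlMr ?exprn_gt0// mulrC -ler_pdivlMr//.
by move=> /(lt_le_trans (lt_le_trans Mk k2)); rewrite ltxx.
Qed.

(** The right derivative of [w y] is a jump operator applied to [w ^~ t], up to an error [e]. The
    list [J] and the step bound [d] may depend on [y] and [e], but not on [t]. *)
Definition jump_equation C K w :=
  forall y e, C y -> 0 < e -> exists J d, [/\ rated_jumps C K J, 0 < d &
    forall t h, 0 <= t -> 0 < h < d ->
      `|w y (t + h) - w y t - h * jump_part J (w ^~ t) y| <= h * e].

(** On a short window that starts at a zero of [w], the bound [M] can be halved indefinitely, so [w]
    vanishes there. Windows of one fixed length then cover the half-line. *)
Lemma jump_equation_eq0 C K M w : jump_equation C K w ->
  (forall y t, C y -> 0 <= t -> `|w y t| <= M) ->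
  (forall y, C y -> w y 0 = 0) ->
  forall y t, C y -> 0 <= t -> w y t = 0.
Proof.
move=> wK wM w0.
(* A positive upper bound of [K], so that the window length [tau] is well defined. *)
pose k := `|K| + 1; have k0 : 0 < k by rewrite ltr_wpDl.
have Kk : K <= k by rewrite (le_trans (ler_norm _))// lerDl.
(* If [w] is bounded by [N], its slope is at most [2 * k * N], hence its growth over a window is at
   most [N / 2]. *)
pose tau := (4 * k)^-1; have tau0 : 0 < tau by rewrite invr_gt0 mulr_gt0.
(* By the mean value inequality a bound on w over a window of length tau
   starting at a zero of w improves by a factor 2. *)
have half a N : 0 <= a ->
    (forall z r, C z -> a <= r <= a + tau -> `|w z r| <= N) ->
    (forall z, C z -> w z a = 0) ->
    forall z r, C z -> a <= r <= a + tau -> `|w z r| <= N / 2.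
  move=> a0 wN wa z r Cz /andP[ar rat]; apply/ler_addgt0Pr => e e0.
  have N0 : 0 <= N.
    by apply: (le_trans (normr_ge0 (w z a))); rewrite wN// lexx lerDl ltW.
  (* An error rate of [e / tau] accumulates to at most [e] over the window. *)
  have [J [d [CJ d0 Jd]]] := wK z (e / tau) Cz (divr_gt0 e0 tau0).
  have : `|w z r - w z a| <= (r - a) * (k * (N + N) + e / tau).
    apply: (norm_increment_le d0 ar) => s h as_ shr h0d.
    have h0 : 0 < h by case/andP: h0d.
    rewrite -(subrK (h * jump_part J (w ^~ s) z) (w z (s + h) - w z s)).
    rewrite (le_trans (ler_normD _ _))// mulrDr addrC lerD//.
      rewrite normrM gtr0_norm// (ler_wpM2l (ltW h0))//.
      apply: norm_jump_part_le (le_rated_jumps Kk CJ) Cz _ => x Cx.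
      apply: wN => //; rewrite as_/= (le_trans _ rat)// (le_trans _ shr)//.
      by rewrite lerDl ltW.
    by apply: Jd => //; exact: le_trans as_.
  rewrite wa// subr0 => /le_trans; apply.
  apply: (@le_trans _ _ (tau * (k * (N + N) + e / tau))).
    apply: ler_wpM2r; last by rewrite lerBlDl.
    apply: addr_ge0; last by rewrite ltW// divr_gt0.
    by rewrite (mulr_ge0 (ltW k0))// addr_ge0.
  by rewrite le_eqVlt; apply/orP; left; apply/eqP; rewrite /tau; field;
    rewrite gt_eqF.
have step a : 0 <= a -> (forall z, C z -> w z a = 0) ->
    forall z r, C z -> a <= r <= a + tau -> w z r = 0.
  move=> a0 wa z r Cz ra; apply: (@norm_le_geometric_eq0 _ M) => n.
  elim: n z r Cz ra => [|n ih] z r Cz ra.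
    by rewrite expr0 divr1 wM//; case/andP: ra => + _; exact: le_trans.
  by rewrite exprSr invfM mulrA; exact: (half a _ a0 ih wa).
have all_steps n : forall z r, C z -> 0 <= r <= n%:R * tau -> w z r = 0.
  elim: n => [|n ih] z r Cz.
    by rewrite mul0r -eq_le eq_sym => /eqP ->; exact: w0.
  move=> /andP[r0 rn]; have [rt|rt] := leP r (n%:R * tau).
    by apply: ih => //; rewrite r0.
  have n0 : 0 <= n%:R * tau by rewrite mulr_ge0// ltW.
  apply: (step (n%:R * tau)) => //.
    by move=> x Cx; apply: ih => //; rewrite lexx n0.
  by rewrite ltW//= (le_trans rn)// -natr1 mulrDl mul1r.
move=> y t Cy t0; apply: (all_steps (Num.Def.archi_bound (t / tau))) => //.
by rewrite t0/= -ler_pdivrMr// ltW// archi_boundP// divr_ge0// (ltW tau0).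
Qed.

End JumpEquation.

(** * Duality from an identity of generators *)

Lemma indic1E (R : pzRingType) (T : choiceType) (s z : T) :
  \1_[set s] z = (z == s)%:R :> R.
Proof.
by rewrite indicE; congr ((nat_of_bool _)%:R); apply/idP/eqP; rewrite inE.
Qed.

Lemma near_right0P (R : realType) (Q : R -> Prop) :
  (\forall h \near 0^'+, Q h) ->
  exists2 d : R, 0 < d & forall h, 0 < h < d -> Q h.
Proof.
move=> [d /= d0 dQ]; exists d => // h /andP[h0 hd]; apply: dQ => //=.
by rewrite sub0r normrN gtr0_norm.
Qed.

Lemma near_all_seq (R : realType) (I : eqType) (r : seq I)
    (Q : I -> R -> Prop) :
  (forall i, \forall h \near 0^'+, Q i h) ->
  \forall h \near 0^'+, forall i, i \in r -> Q i h.
Proof.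
move=> Qh; elim: r => [|i r ih]; first exact: nearW.
near=> h => j; rewrite inE => /predU1P[->|jr]; first by near: h.
by move: j jr; near: h.
Unshelve. all: by end_near.
Qed.

Section JumpApproximation.
Context (R : realType) (T : choiceType).
Variables (C : set T) (K : R) (L : (T -> R) -> T -> R).

(** One list must serve all test functions bounded by 1: it is later applied to functions that vary
    with time, with an error that must not. *)
Definition jump_approximable := forall y e, C y -> 0 < e ->
  exists J, rated_jumps C K J /\
    forall g, (forall z, `|g z| <= 1) -> `|L g y - jump_part J g y| <= e.

End JumpApproximation.

(** For duplicate-free [S] this is [g] cut off outside [S]. It is written as a combination of point
    masses because the derivative of the sink semigroup is given only on these. *)
Definition truncate (R : realType) (T : choiceType) (S : seq T) (g : T -> R)
  (z : T) : R := \sum_(s <- S) g s * (z == s)%:R.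

Section Truncation.
Context (R : realType) (T : choiceType).
Implicit Types (S : seq T) (g : T -> R).

Lemma truncateE S g z : uniq S -> truncate S g z = if z \in S then g z else 0.
Proof.
move=> uS; rewrite /truncate; case: ifPn => zS.
  rewrite (bigD1_seq z)//= eqxx mulr1 big1 ?addr0// => s /negPf sz.
  by rewrite eq_sym sz mulr0.
rewrite big1_seq// => s /andP[_ sS]; case: eqVneq => [zs|_].
  by rewrite zs sS in zS.
by rewrite mulr0.
Qed.

Lemma norm_truncate_le1 S g z : uniq S -> (forall x, `|g x| <= 1) ->
  `|truncate S g z| <= 1.
Proof.
by move=> uS g1; rewrite truncateE//; case: ifP => // _; rewrite normr0.
Qed.

Lemma jump_part_truncate J S g y :
  jump_part J (truncate S g) y =
  \sum_(s <- S) g s * jump_part J (fun z => (z == s)%:R) y.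
Proof.
rewrite /jump_part.
under [RHS]eq_bigr do rewrite mulr_sumr.
rewrite exchange_big/=; apply: eq_bigr => j _.
rewrite /truncate -sumrB mulr_sumr; apply: eq_bigr => s _.
by ring.
Qed.

End Truncation.

(** * Uniform increments of a semigroup on a discrete space *)

Section SinkEstimate.
Context (R : realType) (dO d : measure_display).
Context (Omega : measurableType dO) (E : measurableType d).
Variables (P : E -> probability Omega R) (X : R -> Omega -> E).
Hypothesis PX : markov_process P X.
Hypothesis discreteE : forall U : set E, measurable U.
Variables (C : set E) (K : R) (L : (E -> R) -> E -> R).
Hypothesis LC : jump_approximable C K L.
Hypothesis LX : forall y z, C y ->
  (semigroup P X h \1_[set z] y - \1_[set z] y) / h @[h --> 0^'+] -->
    L \1_[set z] y.

Let measurable_all (f : E -> R) : measurable_fun setT f.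
Proof. by move=> _ U _; exact: discreteE. Qed.

Let point_mass (s z : E) : R := (z == s)%:R.

Let norm_point_mass_le1 s z : `|point_mass s z| <= 1.
Proof. by rewrite /point_mass; case: (_ == _); rewrite ?normr1 ?normr0. Qed.

(** Four errors of size [e] add up: from difference quotients to [L] on the point masses of [S],
    from there to an auxiliary list [J'], from [J'] back to [L] on the truncation of [g], and from
    [L] to [J]. *)
Lemma truncated_increment_estimate S J y e h : uniq S -> C y -> 0 < e ->
  y \in S -> (forall j, j \in J -> j.2 \in S) ->
  (forall g, (forall z, `|g z| <= 1) -> `|L g y - jump_part J g y| <= e) ->
  (forall s, s \in S ->
    `|(semigroup P X h (point_mass s) y - point_mass s y) / h
      - L (point_mass s) y| <= e / (size S)%:R) ->
  forall g, (forall z, `|g z| <= 1) ->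
    `|\sum_(s <- S) g s *
        ((semigroup P X h (point_mass s) y - point_mass s y) / h) -
      jump_part J g y| <= 4 * e.
Proof.
move=> uS Cy e0 yS JS LJ hS g g1; set n : R := (size S)%:R in hS.
have n1 : 1 <= n by rewrite ler1n; case: (S) yS.
have n0 : 0 < n by exact: lt_le_trans n1.
have en0 : 0 < e / n by rewrite divr_gt0.
have en_le_e : e / n <= e by rewrite ler_pdivrMr// ler_peMr// ltW.
have sum_le (F G : E -> R) : (forall z, z \in S -> `|F z - G z| <= e / n) ->
    `|\sum_(s <- S) g s * F s - \sum_(s <- S) g s * G s| <= e.
  move=> FG; rewrite -sumrB (le_trans (ler_norm_sum _ _ _))//.
  apply: (@le_trans _ _ (\sum_(s <- S) (e / n))).
    rewrite !big_seq; apply: ler_sum => s sS.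
    by rewrite -mulrBr normrM (le_trans _ (FG s sS))// ler_piMl.
  rewrite big_const_seq count_predT iter_addr_0 -mulr_natl -/n.
  by rewrite mulrC divfK// gt_eqF.
(* The jump part of [J'] is linear in the test function, which is how the point masses are
   recombined. The accuracy [e / n] compensates for the [n] terms. *)
have [J' [_ LJ']] := LC Cy en0.
have S1 := sum_le _ _ hS.
have S2 : `|\sum_(s <- S) g s * L (point_mass s) y
    - \sum_(s <- S) g s * jump_part J' (point_mass s) y| <= e.
  by apply: sum_le => s sS; apply: LJ'.
have tg z := norm_truncate_le1 z uS g1.
have S3 := le_trans (LJ' _ tg) en_le_e.
have S4 := LJ _ tg.
rewrite -jump_part_truncate in S2.
(* [S] contains [y] and every target of [J], so the cutoff is invisible to [J]. *)
have jE : jump_part J (truncate S g) y = jump_part J g y.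
  rewrite /jump_part !big_seq; apply: eq_bigr => j jJ.
  by rewrite !truncateE// yS JS.
rewrite jE in S4; move: S1 S2 S3 S4; rewrite !ler_norml.
move=> /andP[? ?] /andP[? ?] /andP[? ?] /andP[? ?].
by apply/andP; split; lra.
Qed.

Lemma sink_increment_estimate y e : C y -> 0 < e ->
  exists J del, [/\ rated_jumps C K J, 0 < del,
    forall g, (forall z, `|g z| <= 1) -> `|L g y - jump_part J g y| <= e &
    forall g h, (forall z, `|g z| <= 1) -> 0 < h < del ->
      `|semigroup P X h g y - g y - h * jump_part J g y| <= h * (8 * e)].
Proof.
move=> Cy e0; have [J [CJ LJ]] := LC Cy e0.
(* Only these finitely many states are tested, so entrywise convergence provides a common range of
   [h]. In the final bound [8 * e], one [4 * e] is for the mass in [S] and one for the mass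
   outside. *)
pose S := undup (y :: [seq j.2 | j <- J]).
have uS : uniq S by exact: undup_uniq.
have yS : y \in S by rewrite mem_undup mem_head.
have JS j : j \in J -> j.2 \in S.
  by move=> jJ; rewrite mem_undup in_cons map_f ?orbT.
have en0 : 0 < e / (size S)%:R.
  by rewrite divr_gt0// ltr0n; case: (S) yS.
have : \forall h \near 0^'+, forall s, s \in S ->
    `|(semigroup P X h (point_mass s) y - point_mass s y) / h
      - L (point_mass s) y| <= e / (size S)%:R.
  apply: near_all_seq => s.
  have -> : point_mass s = \1_[set s] by apply/funext => z; rewrite indic1E.
  have /cvgrPdist_le/(_ _ en0) := @LX y s Cy.
  by apply: filterS => h; rewrite distrC.
move=> /near_right0P[del del0 dS]; exists J, del; split => //.
move=> g h g1 /[dup] hd /andP[h0 _].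
have est := truncated_increment_estimate uS Cy e0 yS JS LJ (dS h hd).
have gE := est g g1.
have one1 (z : E) : `|1 : R| <= 1 by rewrite normr1.
have oneE := est (fun=> 1) one1.
have J1 : jump_part J (fun=> 1) y = 0.
  by rewrite /jump_part big1// => j _; rewrite subrr mulr0.
rewrite J1 subr0 in oneE.
have sgt f : (forall z, `|f z| <= 1) ->
    semigroup P X h (truncate S f) y =
    \sum_(s <- S) f s * semigroup P X h (point_mass s) y.
  move=> f1; rewrite (semigroup_sum PX (M := fun=> 1) _ y (ltW h0))//; last first.
    move=> s z; rewrite normrM (le_trans _ (f1 s))// ler_piMr//.
    exact: norm_point_mass_le1.
  apply: eq_bigr => s _.
  exact: (semigroupZ PX _ _ (ltW h0) _ (norm_point_mass_le1 s)).
have incr f : (forall z, `|f z| <= 1) ->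
    \sum_(s <- S) f s *
      ((semigroup P X h (point_mass s) y - point_mass s y) / h) =
    (semigroup P X h (truncate S f) y - f y) / h.
  move=> f1; rewrite sgt// mulrBl mulr_suml.
  have <- : truncate S f y = f y by rewrite truncateE// yS.
  rewrite /truncate mulr_suml -sumrB; apply: eq_bigr => s _.
  by rewrite /point_mass; ring.
rewrite incr// in gE; rewrite incr// in oneE.
(* The mass that leaves S is estimated by the case g = 1, for which the jump
   part vanishes. *)
have rest : `|semigroup P X h g y - semigroup P X h (truncate S g) y| <=
    1 - semigroup P X h (truncate S (fun=> 1)) y.
  have tg z := norm_truncate_le1 z uS g1.
  have t1 z := norm_truncate_le1 z uS one1.
  rewrite -[X in _ <= X - _](semigroup_cst P X h 1 y).
  rewrite -(semigroupB PX y (ltW h0) _ g1 _ tg)//.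
  rewrite -(semigroupB PX y (ltW h0) _ one1 _ t1)//.
  have bnd z : `|g z - truncate S g z| <= 1 - truncate S (fun=> 1) z.
    rewrite !truncateE//; case: ifP => _; first by rewrite !subrr normr0.
    by rewrite !subr0.
  apply: (normr_semigroup_le PX (M := 2)) => //; first exact: ltW.
  move=> z; rewrite (_ : 2 = 1 - -1); last by rewrite opprK.
  by rewrite lerD2l lerN2; move: (t1 z); rewrite ler_norml => /andP[].
have hK x c : `|x / h| <= c -> `|x| <= h * c.
  by rewrite normrM normfV (gtr0_norm h0) ler_pdivrMr// mulrC.
have {}oneE := hK _ _ oneE.
have -> : semigroup P X h g y - g y - h * jump_part J g y =
   (semigroup P X h g y - semigroup P X h (truncate S g) y) +
   h * ((semigroup P X h (truncate S g) y - g y) / h - jump_part J g y).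
  by field; rewrite gt_eqF.
rewrite (le_trans (ler_normD _ _))// (_ : h * (8 * e) = h * (4 * e) + h * (4 * e)).
  rewrite lerD//; last by rewrite normrM (gtr0_norm h0) ler_wpM2l// ltW.
  apply: (le_trans rest); apply: le_trans oneE.
  by rewrite -normrN opprB ler_norm.
by ring.
Qed.

End SinkEstimate.

(** * Passage from generators to semigroups *)

Section GeneratorDuality.
Context (R : realType) (dO dO' d d' : measure_display).
Context (Omega : measurableType dO) (Omega' : measurableType dO').
Context (E : measurableType d) (E' : measurableType d').
Variables (P : E -> probability Omega R) (X : R -> Omega -> E).
Variables (P' : E' -> probability Omega' R) (Y : R -> Omega' -> E').
Hypotheses (PX : markov_process P X) (PY : markov_process P' Y).
Hypothesis discreteE' : forall U : set E', measurable U.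
Variables (C : set E') (K : R) (L : (E' -> R) -> E' -> R).
Hypothesis LC : jump_approximable C K L.
Hypothesis LY : forall y z, C y ->
  (semigroup P' Y h \1_[set z] y - \1_[set z] y) / h @[h --> 0^'+] -->
    L \1_[set z] y.
Variable D : E -> E' -> R.
Hypothesis D01 : forall x y, 0 <= D x y <= 1.
Hypothesis measurableD : forall y, measurable_fun setT (D ^~ y).
Hypothesis LX : forall y e, C y -> 0 < e -> \forall h \near 0^'+, forall x,
  `|(semigroup P X h (D ^~ y) x - D x y) / h - L (D x) y| <= e.

Let normD x y : `|D x y| <= 1.
Proof. by case/andP: (D01 x y) => ? ?; rewrite ger0_norm. Qed.

Let D0 x y : 0 <= D x y. Proof. by case/andP: (D01 x y). Qed.

Let measurable_all (f : E' -> R) : measurable_fun setT f.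
Proof. by move=> _ U _; exact: discreteE'. Qed.

Let u x y t := semigroup P X t (D ^~ y) x.
Let v x y t := semigroup P' Y t (D x) y.

(** The increment of [u] is the time-[t] semigroup applied to the increment of the time-[h]
    semigroup on [D ^~ y]. The latter is controlled uniformly in the starting point, the time-[t]
    semigroup is a contraction, and it commutes with the finite sum in [jump_part]. The two errors
    [e] come from [LX] and from the list. *)
Let forward_increment y e J : C y -> 0 < e ->
  (forall g, (forall z, `|g z| <= 1) -> `|L g y - jump_part J g y| <= e) ->
  exists2 del, 0 < del & forall x t h, 0 <= t -> 0 < h < del ->
    `|u x y (t + h) - u x y t - h * jump_part J (u x ^~ t) y| <= h * (2 * e).
Proof.
move=> Cy e0 LJ; have [del del0 Ldel] := near_right0P (LX Cy e0).
exists del => // x t h t0 /[dup] hdel /andP[h0 _].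
have mS : measurable_fun setT (semigroup P X h (D ^~ y)).
  by apply: measurable_semigroup => //; exact: ltW.
have SM z : `|semigroup P X h (D ^~ y) z| <= 1.
  by apply: normr_semigroup_le_cst => //; exact: ltW.
have mterm (j : R * E') :
    measurable_fun setT (fun z => j.1 * (D z j.2 - D z y)).
  by apply: measurable_funM => //; exact: measurable_funB.
have term_le (j : R * E') z : `|j.1 * (D z j.2 - D z y)| <= `|j.1| * 2.
  rewrite normrM ler_wpM2l// (le_trans (ler_normB _ _))//.
  by rewrite (_ : 2 = 1 + 1)// lerD.
have JE : jump_part J (u x ^~ t) y =
    semigroup P X t (fun z => jump_part J (D z) y) x.
  rewrite /jump_part (semigroup_sum PX _ x t0 mterm term_le).
  apply: eq_bigr => j _; rewrite (semigroupZ PX (M := 2))//.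
  - by rewrite (semigroupB PX (M := 1) (N := 1)).
  - exact: measurable_funB.
  - by move=> z; rewrite (le_trans (ler_normB _ _))// (_ : 2 = 1 + 1)// lerD.
have mJ : measurable_fun setT (fun z => jump_part J (D z) y).
  exact: measurable_sum.
pose M := \sum_(j <- J) `|j.1| * 2.
have JM z : `|jump_part J (D z) y| <= M.
  by rewrite (le_trans (ler_norm_sum _ _ _))// ler_sum.
have -> : u x y (t + h) - u x y t - h * jump_part J (u x ^~ t) y =
    semigroup P X t (fun z => semigroup P X h (D ^~ y) z - D z y
      - h * jump_part J (D z) y) x.
  rewrite /u (semigroup_add PX t0 (ltW h0) (M := 1))//.
  rewrite (semigroupB PX (M := 2) (N := h * M))//.
  - rewrite (semigroupB PX (M := 1) (N := 1))//.
    by rewrite (semigroupZ PX h x t0 mJ JM) -JE.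
  - exact: measurable_funB.
  - by move=> z; rewrite (le_trans (ler_normB _ _))// (_ : 2 = 1 + 1)// lerD.
  - exact: measurable_funM.
  - by move=> z; rewrite normrM (gtr0_norm h0) ler_wpM2l// ltW.
apply: normr_semigroup_le_cst => //.
  by apply: measurable_funB; [exact: measurable_funB|exact: measurable_funM].
move=> z; have := Ldel h hdel z; have := LJ (D z) (normD z).
set a := L (D z) y; set b := jump_part J (D z) y.
set c := semigroup P X h (D ^~ y) z - D z y => ab ca.
have -> : c - h * b = h * ((c / h - a) + (a - b)).
  by field; rewrite gt_eqF.
rewrite normrM (gtr0_norm h0) ler_wpM2l ?(ltW h0)//.
by rewrite (le_trans (ler_normD _ _))// (_ : 2 * e = e + e) ?lerD//; ring.
Qed.

Theorem semigroup_duality x y t : C y -> 0 <= t ->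
  semigroup P X t (D ^~ y) x = semigroup P' Y t (D x) y.
Proof.
move=> Cy t0; apply/eqP; rewrite -subr_eq0; apply/eqP.
pose w z r := u x z r - v x z r.
apply: (@jump_equation_eq0 _ _ C K 2 w) => //.
(* The increments of [u] cost [2 * e'] and those of [v] cost [8 * e']. *)
- move=> z e Cz e0; pose e' := e / 10.
  have e'0 : 0 < e' by rewrite divr_gt0.
  have [J [d1 [CJ d10 LJ Yd1]]] :=
    sink_increment_estimate PY discreteE' LC LY Cz e'0.
  have [d2 d20 Xd2] := forward_increment Cz e'0 LJ.
  exists J, (Num.min d1 d2); split => //; first by rewrite lt_min d10.
  move=> r h r0 /andP[h0]; rewrite lt_min => /andP[hd1 hd2].
  have hh1 : 0 < h < d1 by rewrite h0.
  have hh2 : 0 < h < d2 by rewrite h0.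
  have nv a : `|v x a r| <= 1 by exact: normr_semigroup_le_cst.
  have := Yd1 _ _ nv hh1; have := Xd2 x r h r0 hh2.
  (* For [v] the short step is run first, the opposite order to that used for [u]: the small
     increment acts on the dual starting point [z]. *)
  have -> : semigroup P' Y h (fun a => v x a r) z = v x z (r + h).
    by rewrite addrC /v (semigroup_add PY (ltW h0) r0 (M := 1)).
  set a := _ - _ - _; set b := _ - _ - _ => aB bB.
  have -> : w z (r + h) - w z r - h * jump_part J (w^~ r) z = a - b.
    rewrite /a /b /w.
    have -> : jump_part J ((fun y0 t0 => u x y0 t0 - v x y0 t0)^~ r) z =
        jump_part J (u x ^~ r) z - jump_part J (v x ^~ r) z.
      by rewrite /jump_part -sumrB; apply: eq_bigr => j _; ring.
    by ring.
  rewrite (le_trans (ler_normB _ _))// (le_trans (lerD aB bB))//.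
  by rewrite -mulrDr -mulrDl /e' le_eqVlt; apply/orP; left; apply/eqP; field.
- move=> z r _ r0; rewrite (le_trans (ler_normB _ _))// (_ : 2 = 1 + 1)//.
  by rewrite lerD//; apply: normr_semigroup_le_cst.
- by move=> z _; rewrite /w /u /v (semigroup0 PX)// (semigroup0 PY)// subrr.
Qed.

End GeneratorDuality.

(** * Absolutely summable families *)

Lemma esum_le_fin (R : realType) (I : choiceType) (a : I -> R) (M : R) :
  (forall r, uniq r -> \sum_(i <- r) a i <= M) ->
  (\esum_(i in [set: I]) (a i)%:E <= M%:E)%E.
Proof.
move=> aM; apply: ge_ereal_sup => _ [X [finX _]] <-.
rewrite fsbig_finite//= sumEFin lee_fin; apply: aM; exact: fset_uniq.
Qed.

Lemma sum_le_esum (R : realType) (I : choiceType) (a : I -> R) (M : R) r :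
  (\esum_(i in [set: I]) (a i)%:E <= M%:E)%E -> uniq r -> \sum_(i <- r) a i <= M.
Proof.
move=> aM ur; rewrite -lee_fin; apply: le_trans aM.
rewrite -sumEFin fsbig_seq//; apply: ereal_sup_ubound.
by exists [set` r] => //; split => //; exact: finite_seq.
Qed.

Section Rsum.
Context (R : realType) (I : choiceType).
Implicit Types (a b c F G : I -> R) (A : set I).

Definition nnsum A a : R := fine (\esum_(i in A) (a i)%:E)%E.

Definition finite_nnsum a := (\esum_(i in [set: I]) (a i)%:E < +oo)%E.

Lemma finite_nnsum_le a (M : R) :
  (forall r, uniq r -> \sum_(i <- r) a i <= M) -> finite_nnsum a.
Proof.
by move=> aM; exact: le_lt_trans (esum_le_fin aM) (ltry _).
Qed.

Lemma le_finite_nnsum a b : (forall i, a i <= b i) ->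
  finite_nnsum b -> finite_nnsum a.
Proof.
by move=> ab; apply: le_lt_trans; apply: le_esum => i _; rewrite lee_fin.
Qed.

Lemma finite_nnsumD a b : (forall i, 0 <= a i) -> (forall i, 0 <= b i) ->
  finite_nnsum a -> finite_nnsum b -> finite_nnsum (fun i => a i + b i).
Proof.
move=> a0 b0 fa fb; rewrite /finite_nnsum.
under eq_esum do rewrite EFinD.
by rewrite esumD ?lte_add_pinfty// => i _; rewrite lee_fin.
Qed.

Lemma nnsum_fin_num A a : (forall i, 0 <= a i) -> finite_nnsum a ->
  (\esum_(i in A) (a i)%:E)%E \is a fin_num.
Proof.
move=> a0 fa; have sA : (0 <= \esum_(i in A) (a i)%:E)%E.
  by apply: esum_ge0 => i _; rewrite lee_fin.
rewrite ge0_fin_numE//; apply: le_lt_trans fa.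
rewrite [leRHS](esumID A) ?setTI; last by move=> i _; rewrite lee_fin.
by rewrite leeDl// esum_ge0// => i _; rewrite lee_fin.
Qed.

Lemma nnsum_ge0 A a : (forall i, 0 <= a i) -> 0 <= nnsum A a.
Proof. by move=> a0; rewrite fine_ge0// esum_ge0// => i _; rewrite lee_fin. Qed.

Lemma le_nnsum A a b : (forall i, 0 <= a i) -> finite_nnsum b ->
  (forall i, a i <= b i) -> nnsum A a <= nnsum A b.
Proof.
move=> a0 fb ab.
have b0 i : 0 <= b i by exact: le_trans (ab i).
rewrite fine_le ?nnsum_fin_num//; first exact: le_finite_nnsum fb.
by apply: le_esum => i _; rewrite lee_fin.
Qed.

Lemma nnsumD A a b : (forall i, 0 <= a i) -> (forall i, 0 <= b i) ->
  finite_nnsum a -> finite_nnsum b ->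
  nnsum A (fun i => a i + b i) = nnsum A a + nnsum A b.
Proof.
move=> a0 b0 fa fb; rewrite /nnsum -fineD ?nnsum_fin_num// -esumD//=.
  by move=> i _; rewrite lee_fin.
by move=> i _; rewrite lee_fin.
Qed.

Lemma nnsum_split (X : {fset I}) a : (forall i, 0 <= a i) -> finite_nnsum a ->
  nnsum setT a = \sum_(i <- X) a i + nnsum (~` [set` X]) a.
Proof.
move=> a0 fa; rewrite /nnsum (esumID [set` X]); last first.
  by move=> i _; rewrite lee_fin.
rewrite !setTI fineD ?nnsum_fin_num//; congr (_ + _).
rewrite esum_fset//; last by move=> i _; rewrite lee_fin.
by rewrite fsbig_finite//= set_fsetK sumEFin.
Qed.

Lemma rsumB a b : (forall i, 0 <= a i) -> (forall i, 0 <= b i) ->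
  finite_nnsum a -> finite_nnsum b ->
  rsum (fun i => a i - b i) = nnsum setT a - nnsum setT b.
Proof.
move=> a0 b0 fa fb.
have sa : summable setT (EFin \o a).
  by rewrite /summable; under eq_esum do rewrite /= ger0_norm//.
have sb : summable setT (EFin \o b).
  by rewrite /summable; under eq_esum do rewrite /= ger0_norm//.
have a0' i : [set: I] i -> (0 <= (EFin \o a) i)%E by rewrite lee_fin.
have b0' i : [set: I] i -> (0 <= (EFin \o b) i)%E by rewrite lee_fin.
have := esumB sa sb a0' b0'.
have -> : ((EFin \o a) \- (EFin \o b))%E = EFin \o (fun i => a i - b i).
  by [].
move=> /(congr1 fine).
(* [a + b] dominates both the positive and the negative part of [a - b]. *)
have dom : finite_nnsum (fun i => a i + b i) by exact: finite_nnsumD.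
have fpos : (\esum_(i in [set: I]) (EFin \o (fun i => a i - b i)%R)^\+ i)%E
    \is a fin_num.
  rewrite (@eq_esum _ _ _ _ (fun i => (Num.max (a i - b i) 0)%:E)); last first.
    by move=> i _; rewrite funeposE EFin_max.
  apply: nnsum_fin_num.
    by move=> i; rewrite le_max lexx orbT.
  by apply: le_finite_nnsum dom => i; rewrite ge_max addr_ge0// lerD2l ge0_cp.
have fneg : (\esum_(i in [set: I]) (EFin \o (fun i => a i - b i)%R)^\- i)%E
    \is a fin_num.
  rewrite (@eq_esum _ _ _ _ (fun i => (Num.max (- (a i - b i)) 0)%:E));
    last by move=> i _; rewrite funenegE EFin_max.
  apply: nnsum_fin_num.
    by move=> i; rewrite le_max lexx orbT.
  apply: le_finite_nnsum dom => i; rewrite ge_max addr_ge0// opprB addrC.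
  by rewrite lerD2r ge0_cp.
by rewrite !fineB// ?nnsum_fin_num.
Qed.

Definition abs_summable F := finite_nnsum (fun i => `|F i|).

Lemma abs_summable_le F c : (forall i, `|F i| <= c i) ->
  finite_nnsum c -> abs_summable F.
Proof. exact: le_finite_nnsum. Qed.

(* Writing F = c - (c - F) reduces signed sums to nonnegative ones. *)
Lemma rsum_dominated F c : (forall i, `|F i| <= c i) -> finite_nnsum c ->
  [/\ forall i, 0 <= c i, forall i, 0 <= c i - F i,
      finite_nnsum (fun i => c i - F i) &
      rsum F = nnsum setT c - nnsum setT (fun i => c i - F i)].
Proof.
move=> Fc fc.
have c0 i : 0 <= c i := le_trans (normr_ge0 _) (Fc i).
have d0 i : 0 <= c i - F i by rewrite subr_ge0 (le_trans (ler_norm _)).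
have fd : finite_nnsum (fun i => c i - F i).
  apply: (@le_finite_nnsum _ (fun i => c i + c i)).
    by move=> i; rewrite lerD2l (le_trans _ (Fc i))// -normrN ler_norm.
  exact: finite_nnsumD.
split => //; rewrite -rsumB//; congr rsum; apply/funext => i.
by rewrite subKr.
Qed.

Lemma rsumD F G : abs_summable F -> abs_summable G ->
  rsum (fun i => F i + G i) = rsum F + rsum G.
Proof.
move=> fF fG.
have [a0 b0 fb ->] := rsum_dominated (fun i => lexx `|F i|) fF.
have [c0 d0 fd ->] := rsum_dominated (fun i => lexx `|G i|) fG.
rewrite (addrACA (nnsum _ _)) -opprD -(nnsumD _ a0 c0 fF fG).
rewrite -(nnsumD _ b0 d0 fb fd) -rsumB.
- by congr rsum; apply/funext => i; ring.
- by move=> i; rewrite addr_ge0.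
- by move=> i; rewrite addr_ge0.
- exact: finite_nnsumD.
- exact: finite_nnsumD.
Qed.

(** The list is chosen from the tail of the dominating family [c] alone, hence is common to all [F]
    below it. *)
Lemma rsum_approx c (e : R) : (forall i, 0 <= c i) -> finite_nnsum c -> 0 < e ->
  exists r : seq I, uniq r /\ forall F, (forall i, `|F i| <= c i) ->
    `|rsum F - \sum_(i <- r) F i| <= e.
Proof.
move=> c0 fc e0.
have e2 : 0 < e / 2 by rewrite divr_gt0.
have [X Xe] : exists X : {fset I}, nnsum (~` [set` X]) c <= e / 2.
  have : ((nnsum setT c - e / 2)%:E < \esum_(i in [set: I]) (c i)%:E)%E.
    rewrite -[X in (_ < X)%E]fineK ?nnsum_fin_num//.
    by rewrite lte_fin ltrBlDr ltrDl.
  move=> /ereal_sup_gt[_ [X [finX _]] <-].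
  rewrite fsbig_finite//= sumEFin lte_fin => lt_sum.
  exists (fset_set X); move: lt_sum; rewrite (nnsum_split (fset_set X))//.
  by lra.
exists X; split => // F Fc.
have [_ d0 fd ->] := rsum_dominated Fc fc.
rewrite (nnsum_split X c0 fc) (nnsum_split X d0 fd) sumrB.
set tc := nnsum _ c in Xe *; set td := nnsum _ _.
have tc0 : 0 <= tc by exact: nnsum_ge0.
have td0 : 0 <= td by exact: nnsum_ge0.
have td2 : td <= tc + tc.
  rewrite /tc -nnsumD//; apply: le_nnsum => //; first exact: finite_nnsumD.
  by move=> i; rewrite lerD2l (le_trans _ (Fc i))// -normrN ler_norm.
by rewrite ler_norml; apply/andP; split; lra.
Qed.

End Rsum.

Lemma rsum_bij (R : realType) (I J : choiceType) (e : I -> J) (F : J -> R) :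
  bijective e -> rsum F = rsum (F \o e).
Proof.
move=> be; have e_bij : set_bij [set: I] [set: J] e.
  by rewrite setTT_bijective.
rewrite /rsum (reindex_esum setT setT e)//.
rewrite [X in _ - fine X = _](reindex_esum setT setT e)//.
by congr (fine _ - fine _); apply: eq_esum => i _;
  rewrite ?funeposE ?funenegE.
Qed.

(** Swapping the coordinates preserves the sum, so twice [rsum F] is the sum of the symmetrized
    family. *)
Lemma rsum_symmetrized (R : realType) (I : choiceType) (F G : I * I -> R) :
  abs_summable F -> abs_summable G ->
  (forall x y, F (x, y) + F (y, x) = G (x, y) + G (y, x)) -> rsum F = rsum G.
Proof.
move=> fF fG FG; pose sw (z : I * I) := (z.2, z.1).
have swK : involutive sw by case.
have bsw : bijective sw by exists sw.
have fsw (H : I * I -> R) : abs_summable H -> abs_summable (H \o sw).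
  rewrite /abs_summable /finite_nnsum => fH.
  rewrite -(reindex_esum setT setT sw (fun z => `|H z|%:E))//.
  by rewrite setTT_bijective.
have double (H : I * I -> R) : abs_summable H ->
    rsum (fun z => H z + (H \o sw) z) = rsum H + rsum H.
  by move=> fH; rewrite rsumD//; [rewrite -rsum_bij|exact: fsw].
have : rsum F + rsum F = rsum G + rsum G.
  rewrite -!double//; congr rsum; apply/funext => -[x y]; exact: FG.
by move=> ?; lra.
Qed.

(** * Single-site weights and finitely supported products *)

Section SiteWeight.
Context (R : realType) (m : nat).

(** For [a] and [k] at most [m]: the probability that [k] slots drawn without replacement from [m]
    all lie among the [a] occupied ones. *)
Definition site_weight (a k : nat) : R :=
  'C(a, k)%:R / 'C(m, k)%:R * (k <= a)%N%:R.

Local Notation wt := site_weight.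

Lemma site_weightE a k : wt a k = 'C(a, k)%:R / 'C(m, k)%:R.
Proof.
rewrite /wt; case: leqP => [_|ak]; first by rewrite mulr1.
by rewrite bin_small// mulr0 mul0r.
Qed.

Lemma site_weight0 a : wt a 0 = 1.
Proof. by rewrite site_weightE !bin0 divr1. Qed.

Lemma site_weight_ge0_le1 a k : (a <= m)%N -> 0 <= wt a k <= 1.
Proof.
move=> am; rewrite site_weightE divr_ge0//=.
have [->|C0] := eqVneq 'C(m, k) 0%N; first by rewrite invr0 mulr0.
by rewrite ler_pdivrMr ?mul1r ?ler_nat ?leq_bin2l// ltr0n lt0n.
Qed.

Let bin_step a k : k.+1%:R * 'C(a, k.+1)%:R = (a%:R - k%:R) * 'C(a, k)%:R :> R.
Proof.
rewrite -natrM mul_bin_left natrM; have [ka|ak] := leqP k a.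
  by rewrite natrB.
by rewrite bin_small// !mulr0.
Qed.

(** This and the next two recurrences trade a change of the occupation [a] or of the dual occupation
    [k] for explicit coefficients. Subtraction is real; for [a < k] both sides vanish. *)
Lemma site_weight_lower a k : a%:R * wt a.-1 k = (a%:R - k%:R) * wt a k.
Proof.
rewrite !site_weightE !mulrA; congr (_ / _).
rewrite -natrM mul_bin_down natrM; have [ka|ak] := leqP k a.
  by rewrite natrB.
by rewrite bin_small// !mulr0.
Qed.

(** Once [k] occupied slots are drawn, [a - k] of the remaining [m - k] are occupied. The case
    [k = m] is separate because the ratio is then undefined. *)
Lemma site_weight_dual_raise a k : (a <= m)%N -> (k <= m)%N ->
  (m%:R - k%:R) * wt a k.+1 = (a%:R - k%:R) * wt a k.
Proof.
rewrite !site_weightE => am; rewrite leq_eqVlt => /predU1P[->|km].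
  rewrite subrr mul0r; move: am; rewrite leq_eqVlt => /predU1P[->|am].
    by rewrite subrr mul0r.
  by rewrite bin_small// mul0r mulr0.
have mk0 : m%:R - k%:R != 0 :> R.
  by rewrite -natrB ?pnatr_eq0 -?lt0n ?subn_gt0// ltnW.
have k0 : k.+1%:R != 0 :> R by rewrite pnatr_eq0.
have c0 : 'C(m, k)%:R != 0 :> R by rewrite pnatr_eq0 -lt0n bin_gt0 ltnW.
have E n : 'C(n, k.+1)%:R = (n%:R - k%:R) * 'C(n, k)%:R / k.+1%:R :> R.
  by rewrite -bin_step mulrC mulKf.
by rewrite !E; field; rewrite c0 mk0 addrC natr1 k0.
Qed.

(** Pascal's rule for ['C(a.+1, k)]. At [k = 0] the truncated [k.-1] is multiplied by zero. *)
Lemma site_weight_raise a k : (a <= m)%N -> (k <= m)%N ->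
  (m%:R - a%:R) * wt a.+1 k =
  k%:R * wt a k.-1 + (m%:R - a%:R - k%:R) * wt a k.
Proof.
rewrite !site_weightE => am; case: k => [|j] jm.
  by rewrite mul0r add0r subr0 !bin0.
have mj0 : m%:R - j%:R != 0 :> R.
  by rewrite -natrB ?pnatr_eq0 -?lt0n ?subn_gt0// ltnW.
have j0 : j.+1%:R != 0 :> R by rewrite pnatr_eq0.
have c0 : 'C(m, j)%:R != 0 :> R by rewrite pnatr_eq0 -lt0n bin_gt0 ltnW.
have E n : 'C(n, j.+1)%:R = (n%:R - j%:R) * 'C(n, j)%:R / j.+1%:R :> R.
  by rewrite -bin_step mulrC mulKf.
rewrite binS natrD !E /= -natr1; field.
by rewrite c0 mj0 natr1 j0.
Qed.

(** The recurrences reduce both sides to combinations of products of [wt a k], [wt a k.-1], [wt b l]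
    and [wt b l.-1], which agree once the two orientations are added. *)
Lemma exchange_identity a b k l :
  (a <= m)%N -> (b <= m)%N -> (k <= m)%N -> (l <= m)%N ->
  a%:R * (m%:R - b%:R) * (wt a.-1 k * wt b.+1 l - wt a k * wt b l) +
  b%:R * (m%:R - a%:R) * (wt a.+1 k * wt b.-1 l - wt a k * wt b l) =
  k%:R * (m%:R - l%:R) * (wt a k.-1 * wt b l.+1 - wt a k * wt b l) +
  l%:R * (m%:R - k%:R) * (wt a k.+1 * wt b l.-1 - wt a k * wt b l).
Proof.
move=> am bm km lm.
have La := site_weight_lower a k; have Lb := site_weight_lower b l.
have Ra := site_weight_raise am km; have Rb := site_weight_raise bm lm.
have Da := site_weight_dual_raise am km.
have Db := site_weight_dual_raise bm lm.
have -> : a%:R * (m%:R - b%:R) * (wt a.-1 k * wt b.+1 l - wt a k * wt b l) =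
    (a%:R * wt a.-1 k) * ((m%:R - b%:R) * wt b.+1 l) -
    a%:R * (m%:R - b%:R) * (wt a k * wt b l) by ring.
have -> : b%:R * (m%:R - a%:R) * (wt a.+1 k * wt b.-1 l - wt a k * wt b l) =
    ((m%:R - a%:R) * wt a.+1 k) * (b%:R * wt b.-1 l) -
    b%:R * (m%:R - a%:R) * (wt a k * wt b l) by ring.
have -> : k%:R * (m%:R - l%:R) * (wt a k.-1 * wt b l.+1 - wt a k * wt b l) =
    k%:R * wt a k.-1 * ((m%:R - l%:R) * wt b l.+1) -
    k%:R * (m%:R - l%:R) * (wt a k * wt b l) by ring.
have -> : l%:R * (m%:R - k%:R) * (wt a k.+1 * wt b l.-1 - wt a k * wt b l) =
    ((m%:R - k%:R) * wt a k.+1) * (l%:R * wt b l.-1) -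
    l%:R * (m%:R - k%:R) * (wt a k * wt b l) by ring.
by rewrite La Lb Ra Rb Da Db; ring.
Qed.

(** Exit and entry together match absorption; the factor [al] on the right is what an absorbed dual
    particle contributes to the duality function. *)
Lemma reservoir_identity (al : R) a k : (a <= m)%N -> (k <= m)%N ->
  (1 - al) * a%:R * (wt a.-1 k - wt a k) +
  al * (m%:R - a%:R) * (wt a.+1 k - wt a k) =
  k%:R * (al * wt a k.-1 - wt a k).
Proof.
move=> am km.
have La := site_weight_lower a k; have Ra := site_weight_raise am km.
have -> : (1 - al) * a%:R * (wt a.-1 k - wt a k) +
  al * (m%:R - a%:R) * (wt a.+1 k - wt a k) =
  (1 - al) * (a%:R * wt a.-1 k - a%:R * wt a k) +
  al * ((m%:R - a%:R) * wt a.+1 k - (m%:R - a%:R) * wt a k) by ring.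
by rewrite La Ra; ring.
Qed.

End SiteWeight.

(** * Isolating one or two factors of a product *)

Section FiniteProducts.
Context (R : realType) (I : choiceType).
Implicit Types (f g : I -> R).

Definition eventually1 f := exists A : {fset I}, forall i, i \notin A -> f i = 1.

(** Taking [x' = x] removes a single site, so one notion serves bulk edges and reservoir edges. *)
Definition prod_except (x x' : I) f : R :=
  \big[*%R/1]_(z \in [set` [pred z | (z != x) && (z != x')]]) f z.

Lemma eq_prod_except x x' f g :
  (forall z, z != x -> z != x' -> f z = g z) ->
  prod_except x x' f = prod_except x x' g.
Proof.
by move=> fg; apply: eq_fsbigr => z; rewrite inE/= => /andP[]; exact: fg.
Qed.

Lemma fsprodD1 f x : eventually1 f ->
  \big[*%R/1]_(z \in [set: I]) f z = f x * prod_except x x f.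
Proof.
move=> [A fA]; rewrite (fsbigTE (x |` A)%fset); last first.
  by move=> i; rewrite !inE negb_or => /andP[_ /fA].
rewrite (bigD1_seq x)//= ?fset1U1//; congr (_ * _).
rewrite /prod_except -(@bigfs _ _ _ _ (x |` A)%fset)//.
  by apply: eq_bigl => i /=; rewrite andbb.
by move=> z _; rewrite !inE negb_or => /andP[_ /fA].
Qed.

Lemma fsprodD2 f x x' : x != x' -> eventually1 f ->
  \big[*%R/1]_(z \in [set: I]) f z = f x * f x' * prod_except x x' f.
Proof.
move=> xx' [A fA]; rewrite (fsbigTE (x |` (x' |` A))%fset); last first.
  by move=> i; rewrite !inE !negb_or => /and3P[_ _ /fA].
rewrite (bigD1_seq x)//= ?fset1U1// -mulrA; congr (_ * _).
rewrite -big_filter (bigD1_seq x')/=; last 2 first.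
- by rewrite mem_filter !inE eqxx orbT eq_sym xx'.
- exact/filter_uniq/fset_uniq.
congr (_ * _); rewrite big_filter_cond.
rewrite /prod_except -(@bigfs _ _ _ _ (x |` (x' |` A))%fset)//.
by move=> z _; rewrite !inE !negb_or => /and3P[_ _ /fA].
Qed.

End FiniteProducts.

(** * The duality function *)

Lemma prod_exceptC (R : realType) (I : choiceType) (x x' : I) (f : I -> R) :
  prod_except x x' f = prod_except x' x f.
Proof.
by apply: eq_fsbigl; apply/seteqP; split => z /= /andP[? ?]; apply/andP.
Qed.

Section Configurations.
Variables (G : countType) (B : {pred G}) (m : nat).
Implicit Types (s : open_config B m) (h : sink_config B m).

Let ord_le (i : 'I_m.+1) : (i <= m)%N. Proof. by rewrite -ltnS. Qed.

Lemma inord_pred (i : 'I_m.+1) : (inord i.-1 : 'I_m.+1) = i.-1 :> nat.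
Proof. by rewrite inordK// (leq_ltn_trans (leq_pred _)). Qed.

Lemma open_exchange_id s x : (0 < s x)%N -> open_add (open_remove s x) x = s.
Proof.
move=> sx; apply/funext => z; rewrite /open_add /open_remove.
case: eqVneq => // ->.
by apply/val_inj; rewrite /= inord_pred prednK// inordK.
Qed.

Lemma sink_exchange_id h x : (0 < h.1 x)%N -> sink_add (sink_remove h x) x = h.
Proof.
move=> hx; rewrite /sink_add /sink_remove/= [RHS]surjective_pairing.
congr pair; apply/fsfunP => z; rewrite !fsfun_withE.
case: eqVneq => // ->.
by apply/val_inj; rewrite /= ?eqxx inord_pred prednK// inordK.
Qed.

End Configurations.

Section DualityFunction.
Variables (R : realType) (G : countType) (B : {pred G}) (m : nat).
Variable alpha : bdry B -> R.
Implicit Types (s : open_config B m) (h : sink_config B m).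

Local Notation D := (duality_fun alpha).
Local Notation wt := (@site_weight R m).

Definition sink_factor h : R :=
  \big[*%R/1]_(y \in [set: bdry B]) (alpha y ^+ h.2 y).

Definition bulk_weights s h (x : bulk B) : R := wt (s x) (h.1 x).

Lemma duality_funE s h :
  D s h = sink_factor h *
    \big[*%R/1]_(x \in [set: bulk B]) bulk_weights s h x.
Proof. by []. Qed.

Lemma bulk_weights_eventually1 s h : eventually1 (bulk_weights s h).
Proof.
exists (finsupp h.1) => x; rewrite memNfinsupp => /eqP hx.
by rewrite /bulk_weights hx site_weight0.
Qed.

Lemma sink_factor_eventually1 h : eventually1 (fun y => alpha y ^+ h.2 y).
Proof.
by exists (finsupp h.2) => y; rewrite memNfinsupp => /eqP ->; rewrite expr0.
Qed.

Lemma sink_factor_absorb h h' y : h'.2 = h.2 ->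
  sink_factor (sink_absorb h' y) = alpha y * sink_factor h.
Proof.
move=> hh'; rewrite /sink_factor.
rewrite (fsprodD1 y (sink_factor_eventually1 _)).
rewrite [in RHS](fsprodD1 y (sink_factor_eventually1 _)).
rewrite /= fsfun_withE eqxx hh' exprS -mulrA; congr (_ * (_ * _)).
by apply: eq_prod_except => z zy _; rewrite fsfun_withE (negPf zy).
Qed.

(** The product over the other sites refers to the original [s] and [h], so values before and after
    a move share it as a common factor. The sink parts of [h] and [h'] may differ. *)
Lemma duality_fun_site s h s' h' x :
  (forall z, z != x -> s' z = s z) -> (forall z, z != x -> h'.1 z = h.1 z) ->
  D s' h' = sink_factor h' *
    (wt (s' x) (h'.1 x) * prod_except x x (bulk_weights s h)).
Proof.
move=> ss' hh'; rewrite duality_funE (fsprodD1 x (bulk_weights_eventually1 _ _)).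
congr (_ * (_ * _)); apply: eq_prod_except => z zx _.
by rewrite /bulk_weights ss'// hh'.
Qed.

Lemma duality_fun_pair s h s' h' x x' : x != x' ->
  (forall z, z != x -> z != x' -> s' z = s z) ->
  (forall z, z != x -> z != x' -> h'.1 z = h.1 z) ->
  D s' h' = sink_factor h' * (wt (s' x) (h'.1 x) * wt (s' x') (h'.1 x') *
    prod_except x x' (bulk_weights s h)).
Proof.
move=> xx' ss' hh'.
rewrite duality_funE (fsprodD2 xx' (bulk_weights_eventually1 _ _)).
congr (_ * (_ * _)); apply: eq_prod_except => z zx zx'.
by rewrite /bulk_weights ss'// hh'.
Qed.

Lemma duality_open_exchange s h x x' : x != x' -> (s x' < m)%N ->
  D (open_add (open_remove s x) x') h = sink_factor h *
    (wt (s x).-1 (h.1 x) * wt (s x').+1 (h.1 x') *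
     prod_except x x' (bulk_weights s h)).
Proof.
move=> xx' sx'; rewrite (duality_fun_pair (s := s) (h := h) xx')//.
  rewrite /open_add /open_remove eqxx (negPf xx') eqxx eq_sym (negPf xx').
  by rewrite inord_pred inordK.
by move=> z zx zx'; rewrite /open_add /open_remove (negPf zx) (negPf zx').
Qed.

Lemma duality_sink_exchange s h x x' : x != x' -> (h.1 x' < m)%N ->
  D s (sink_add (sink_remove h x) x') = sink_factor h *
    (wt (s x) (h.1 x).-1 * wt (s x') (h.1 x').+1 *
     prod_except x x' (bulk_weights s h)).
Proof.
move=> xx' hx'; rewrite (duality_fun_pair (s := s) (h := h) xx')//.
  rewrite /sink_add /sink_remove/= !fsfun_withE !eqxx (negPf xx').
  by rewrite eq_sym (negPf xx') inord_pred inordK.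
move=> z zx zx'.
by rewrite /sink_add /sink_remove/= !fsfun_withE (negPf zx) (negPf zx').
Qed.

Lemma duality_open_remove s h x : D (open_remove s x) h = sink_factor h *
  (wt (s x).-1 (h.1 x) * prod_except x x (bulk_weights s h)).
Proof.
rewrite (duality_fun_site (s := s) (h := h) (x := x))//.
  by rewrite /open_remove eqxx inord_pred.
by move=> z zx; rewrite /open_remove (negPf zx).
Qed.

Lemma duality_open_add s h x : (s x < m)%N ->
  D (open_add s x) h = sink_factor h *
    (wt (s x).+1 (h.1 x) * prod_except x x (bulk_weights s h)).
Proof.
move=> sx; rewrite (duality_fun_site (s := s) (h := h) (x := x))//.
  by rewrite /open_add eqxx inordK.
by move=> z zx; rewrite /open_add (negPf zx).
Qed.

Lemma duality_sink_absorb s h x y :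
  D s (sink_absorb (sink_remove h x) y) = alpha y * sink_factor h *
    (wt (s x) (h.1 x).-1 * prod_except x x (bulk_weights s h)).
Proof.
rewrite (duality_fun_site (s := s) (h := h) (x := x))//.
  rewrite (@sink_factor_absorb h)//=; congr (_ * (_ * _)).
  by rewrite fsfun_withE eqxx inord_pred.
by move=> z zx; rewrite /= fsfun_withE (negPf zx).
Qed.

End DualityFunction.

(** * Identity of the generators *)

(** Tonelli: the finite sum is below the full double sum, whose inner sums have mass at most 1. *)
Lemma sum_prod_le (R : realType) (I J : choiceType) (c : I -> R)
    (q : I -> J -> R) (M : R) :
  (forall i, 0 <= c i) -> (forall i j, 0 <= q i j) ->
  (forall i r, uniq r -> \sum_(j <- r) q i j <= 1) ->
  (forall r, uniq r -> \sum_(i <- r) c i <= M) ->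
  forall r, uniq r -> \sum_(e <- r) c e.1 * q e.1 e.2 <= M.
Proof.
move=> c0 q0 q1 cM r; apply: sum_le_esum.
have -> : [set: I * J] = [set: I] `*`` (fun=> [set: J]).
  by apply/seteqP; split.
rewrite -(@esum_esum _ _ _ setT (fun=> setT) (fun i j => (c i * q i j)%:E)).
  apply: le_trans (esum_le_fin cM); apply: le_esum => i _.
  apply: esum_le_fin => l ul; rewrite -mulr_sumr.
  by rewrite ler_piMr// q1.
by move=> i j _ _; rewrite lee_fin mulr_ge0.
Qed.

Section Rates.
Variables (R : realType) (G : countType) (p : G -> G -> R).
Hypothesis p_stoch : symmetric_stochastic p.

Let p0 x y : 0 <= p x y. Proof. by case: p_stoch. Qed.
Let pC x y : p x y = p y x. Proof. by case: p_stoch. Qed.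

Lemma sum_rates_le1 (T : choiceType) (f : T -> G) (x : G) (r : seq T) :
  injective f -> uniq r -> \sum_(z <- r) p x (f z) <= 1.
Proof.
move=> f_inj ur; rewrite -(big_map f xpredT (p x)).
apply: (@sum_le_esum _ _ (p x) 1).
  by case: p_stoch => _ ->.
by rewrite map_inj_uniq.
Qed.

End Rates.

(** * Boundedness and locality of the duality function *)

Section DualityBounds.
Variables (R : realType) (G : countType) (B : {pred G}) (m : nat).
Variable alpha : bdry B -> R.
Hypothesis alpha01 : forall y, 0 <= alpha y <= 1.
Implicit Types (s : open_config B m) (h : sink_config B m).

Local Notation D := (duality_fun alpha).

Lemma duality_fun_ge0_le1 s h : 0 <= D s h <= 1.
Proof.
have M01 (a b : R) : 0 <= a <= 1 -> 0 <= b <= 1 -> 0 <= a * b <= 1.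
  by move=> /andP[a0 a1] /andP[b0 b1]; rewrite mulr_ge0// mulr_ile1.
rewrite duality_funE; apply: (M01 _ _).
  rewrite /sink_factor; apply: (big_ind (fun r : R => 0 <= r <= 1)) => [|a b|y _].
  - by rewrite ler01 lexx.
  - exact: M01.
  - by case/andP: (alpha01 y) => a0 a1; rewrite exprn_ge0// exprn_ile1.
apply: (big_ind (fun r : R => 0 <= r <= 1)) => [|a b|x _].
- by rewrite ler01 lexx.
- exact: M01.
- by apply: site_weight_ge0_le1; rewrite -ltnS.
Qed.

Lemma norm_dualityB_le1 s h s' h' : `|D s h - D s' h'| <= 1.
Proof.
have /andP[a0 a1] := duality_fun_ge0_le1 s h.
have /andP[b0 b1] := duality_fun_ge0_le1 s' h'.
by rewrite ler_norml; apply/andP; split; lra.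
Qed.

(** Sites with no dual particle have weight 1. This makes [D ^~ h] a cylinder function and kills
    generator terms away from the support of [h]. *)
Lemma duality_fun_local s s' h : {in finsupp h.1, s =1 s'} -> D s h = D s' h.
Proof.
move=> ss'; rewrite !duality_funE; congr (_ * _); apply: eq_fsbigr => x _.
rewrite /bulk_weights; have [xh|] := boolP (x \in finsupp h.1).
  by rewrite ss'.
by rewrite memNfinsupp => /eqP ->; rewrite !site_weight0.
Qed.

End DualityBounds.

Section GeneratorIdentity.
Variables (R : realType) (G : countType) (p : G -> G -> R) (B : {pred G}).
Variables (m : nat) (alpha : bdry B -> R).
Hypothesis p_stoch : symmetric_stochastic p.
Hypothesis m0 : (0 < m)%N.
Hypothesis alpha01 : forall y, 0 <= alpha y <= 1.
Implicit Types (s : open_config B m) (h : sink_config B m).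

Local Notation D := (duality_fun alpha).

Let p0 x y : 0 <= p x y. Proof. by case: p_stoch. Qed.
Let pC x y : p x y = p y x. Proof. by case: p_stoch. Qed.
Let m_gt0 : 0 < m%:R :> R. Proof. by rewrite ltr0n. Qed.
Let m_neq0 : m%:R != 0 :> R. Proof. by rewrite gt_eqF. Qed.
Let ord_le (i : 'I_m.+1) : (i <= m)%N. Proof. by rewrite -ltnS. Qed.

Let fill (i : 'I_m.+1) : 0 <= (i%:R / m%:R : R) <= 1.
Proof. by rewrite divr_ge0//= ler_pdivrMr// mul1r ler_nat. Qed.

Let room (i : 'I_m.+1) : 0 <= ((m - i)%:R / m%:R : R) <= 1.
Proof. by rewrite divr_ge0//= ler_pdivrMr// mul1r ler_nat leq_subr. Qed.

(** Used to dominate the generator terms: the support is finite and each row of [p] has mass 1. *)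
Let touch h (x : bulk B) : R := (x \in finsupp h.1)%:R.

Let finite_touch_bulk h : finite_nnsum
  (fun e : bulk B * bulk B => touch h e.1 * p (val e.1) (val e.2)).
Proof.
apply: (@finite_nnsum_le _ _ _ (size (finsupp h.1))%:R).
apply: (@sum_prod_le _ _ _ (touch h) (fun x x' => p (val x) (val x'))).
- by move=> x; exact: ler0n.
- by move=> x x'; exact: p0.
- by move=> x r; apply: sum_rates_le1 => //; exact: val_inj.
- move=> r ur; rewrite /touch -natr_sum ler_nat -big_mkcond sum1_count.
  rewrite -size_filter; apply: uniq_leq_size; first exact: filter_uniq.
  by move=> z; rewrite mem_filter => /andP[].
Qed.

Let finite_touch_bdry h : finite_nnsum
  (fun e : bulk B * bdry B => touch h e.1 * p (val e.1) (val e.2)).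
Proof.
apply: (@finite_nnsum_le _ _ _ (size (finsupp h.1))%:R).
apply: (@sum_prod_le _ _ _ (touch h) (fun x x' => p (val x) (val x'))).
- by move=> x; exact: ler0n.
- by move=> x x'; exact: p0.
- by move=> x r; apply: sum_rates_le1 => //; exact: val_inj.
- move=> r ur; rewrite /touch -natr_sum ler_nat -big_mkcond sum1_count.
  rewrite -size_filter; apply: uniq_leq_size; first exact: filter_uniq.
  by move=> z; rewrite mem_filter => /andP[].
Qed.

Let rate_le (r u v t : R) : 0 <= r -> 0 <= u <= 1 -> 0 <= v <= 1 -> `|t| <= 1 ->
  `|r * u * v * t| <= r.
Proof.
move=> r0 /andP[u0 u1] /andP[v0 v1] t1.
rewrite !normrM (ger0_norm r0) (ger0_norm u0) (ger0_norm v0) -!mulrA.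
rewrite ler_piMr// mulr_ile1 ?mulr_ge0// mulr_ile1//.
Qed.

Let open_term s h (e : bulk B * bulk B) : R := let: (x, x') := e in
  p (val x) (val x') * ((s x)%:R / m%:R) * ((m - s x')%:R / m%:R) *
  (D (open_add (open_remove s x) x') h - D s h).

Let sink_term s h (e : bulk B * bulk B) : R := let: (x, x') := e in
  p (val x) (val x') * ((h.1 x)%:R / m%:R) * ((m - h.1 x')%:R / m%:R) *
  (D s (sink_add (sink_remove h x) x') - D s h).

(** A jump of the open process can affect [D ^~ h] when either endpoint meets the support of [h],
    hence the dominating family [c] plus its reversal. *)
Let summable_open_term s h : abs_summable (open_term s h).
Proof.
pose c (e : bulk B * bulk B) := touch h e.1 * p (val e.1) (val e.2).
apply: (@abs_summable_le _ _ _ (fun e => c e + c (e.2, e.1))); last first.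
  apply: finite_nnsumD => [e|e||].
  - by apply: mulr_ge0; [exact: ler0n|exact: p0].
  - by apply: mulr_ge0; [exact: ler0n|exact: p0].
  - exact: finite_touch_bulk.
  - rewrite /finite_nnsum.
    rewrite -(reindex_esum setT setT (fun e => (e.2, e.1)) (fun e => (c e)%:E)).
      exact: finite_touch_bulk.
    by rewrite setTT_bijective; exists (fun e => (e.2, e.1)); case.
move=> [x x']; rewrite /c/=; apply: (@le_trans _ _ (p (val x) (val x') *
    ((x \in finsupp h.1) || (x' \in finsupp h.1))%:R)).
  have [_|/norP[xh xh']] := boolP ((x \in finsupp h.1) || _); last first.
    have -> : D (open_add (open_remove s x) x') h = D s h.
      apply: duality_fun_local => z zh; rewrite /open_add /open_remove.
      rewrite !ifN//; first by apply: contraNneq xh => <-.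
      by apply: contraNneq xh' => <-.
    by rewrite subrr !mulr0 normr0.
  by rewrite mulr1; apply: rate_le; [exact: p0|exact: fill|exact: room|
    exact: norm_dualityB_le1].
rewrite (pC (val x')) -mulrDl mulrC ler_wpM2r ?p0// /touch -natrD ler_nat.
by case: (x \in _); case: (x' \in _).
Qed.

Let summable_sink_term s h : abs_summable (sink_term s h).
Proof.
apply: abs_summable_le (finite_touch_bulk h) => -[x x'].
rewrite /touch/=; have [xh|] := boolP (x \in finsupp h.1).
  by rewrite mul1r; apply: rate_le; [exact: p0|exact: fill|exact: room|
    exact: norm_dualityB_le1].
by rewrite memNfinsupp => /eqP ->; rewrite !mul0r mulr0 !mul0r normr0.
Qed.

(* If s x' = m then open_add returns a junk configuration (inord is out of
   range), but the rate vanishes. *)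
Let exchange_term s h x x' : x != x' ->
  open_term s h (x, x') = p (val x) (val x') / m%:R ^+ 2 * sink_factor alpha h *
    prod_except x x' (bulk_weights R s h) *
    ((s x)%:R * (m%:R - (s x')%:R) *
     (site_weight R m (s x).-1 (h.1 x) * site_weight R m (s x').+1 (h.1 x') -
      site_weight R m (s x) (h.1 x) * site_weight R m (s x') (h.1 x'))).
Proof.
move=> xx'; rewrite /open_term natrB//.
have [sx'|] := ltnP (s x') m; last first.
  move=> ms; have -> : s x' = m :> nat by apply/eqP; rewrite eqn_leq ms ord_le.
  by rewrite subrr mul0r !mulr0 !mul0r !mulr0.
rewrite duality_open_exchange// (duality_fun_pair alpha (s := s) (h := h) xx')//.
by field.
Qed.

Let dual_exchange_term s h x x' : x != x' ->
  sink_term s h (x, x') = p (val x) (val x') / m%:R ^+ 2 * sink_factor alpha h *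
    prod_except x x' (bulk_weights R s h) *
    ((h.1 x)%:R * (m%:R - (h.1 x')%:R) *
     (site_weight R m (s x) (h.1 x).-1 * site_weight R m (s x') (h.1 x').+1 -
      site_weight R m (s x) (h.1 x) * site_weight R m (s x') (h.1 x'))).
Proof.
move=> xx'; rewrite /sink_term natrB//.
have [hx'|] := ltnP (h.1 x') m; last first.
  move=> mh; have -> : h.1 x' = m :> nat.
    by apply/eqP; rewrite eqn_leq mh ord_le.
  by rewrite subrr mul0r !mulr0 !mul0r !mulr0.
rewrite duality_sink_exchange// (duality_fun_pair alpha (s := s) (h := h) xx')//.
by field.
Qed.

(* The terms of a single orientation of the edge do not match. *)
Let exchange_sym s h x x' :
  open_term s h (x, x') + open_term s h (x', x) =
  sink_term s h (x, x') + sink_term s h (x', x).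
Proof.
(* A jump from a site to itself contributes nothing: either the site is empty and the rate is 0, or
   the configuration is restored. *)
have [<-|xx'] := eqVneq x x'.
  rewrite /open_term /sink_term.
  have -> : p (val x) (val x) * ((s x)%:R / m%:R) * ((m - s x)%:R / m%:R) *
      (D (open_add (open_remove s x) x) h - D s h) = 0.
    have [->|sx] := posnP (s x); first by rewrite !mul0r mulr0 !mul0r.
    by rewrite open_exchange_id// subrr mulr0.
  have [->|hx] := posnP (h.1 x); first by rewrite !mul0r mulr0 !mul0r addr0.
  by rewrite sink_exchange_id// subrr mulr0.
have x'x : x' != x by rewrite eq_sym.
rewrite !exchange_term// !dual_exchange_term// (pC (val x')) (prod_exceptC x').
rewrite -!mulrDr; congr (_ * _).
have E := exchange_identity R (ord_le (s x)) (ord_le (s x'))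
  (ord_le (h.1 x)) (ord_le (h.1 x')).
by apply: etrans (etrans E _); ring.
Qed.

Let exit_term s h (e : bulk B * bdry B) : R := let: (x, y) := e in
  p (val x) (val y) * (1 - alpha y) * ((s x)%:R / m%:R) *
  (D (open_remove s x) h - D s h).

Let entry_term s h (e : bulk B * bdry B) : R := let: (x, y) := e in
  p (val y) (val x) * alpha y * ((m - s x)%:R / m%:R) *
  (D (open_add s x) h - D s h).

Let absorb_term s h (e : bulk B * bdry B) : R := let: (x, y) := e in
  p (val x) (val y) * ((h.1 x)%:R / m%:R) *
  (D s (sink_absorb (sink_remove h x) y) - D s h).

Let one_sub_alpha y : 0 <= 1 - alpha y <= 1.
Proof.
case/andP: (alpha01 y) => ? ?.
by rewrite subr_ge0 gerBl; apply/andP.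
Qed.

Let summable_exit_term s h : abs_summable (exit_term s h).
Proof.
apply: abs_summable_le (finite_touch_bdry h) => -[x y].
rewrite /touch/=; have [xh|xh] := boolP (x \in finsupp h.1).
  by rewrite mul1r; apply: rate_le; [exact: p0|exact: one_sub_alpha|
    exact: fill|exact: norm_dualityB_le1].
have -> : D (open_remove s x) h = D s h.
  apply: duality_fun_local => z zh; rewrite /open_remove ifN//.
  by apply: contraNneq xh => <-.
by rewrite subrr mulr0 normr0 mul0r.
Qed.

Let summable_entry_term s h : abs_summable (entry_term s h).
Proof.
apply: abs_summable_le (finite_touch_bdry h) => -[x y].
rewrite /touch/=; have [xh|xh] := boolP (x \in finsupp h.1).
  rewrite mul1r (pC (val x)); apply: rate_le; [exact: p0|exact: alpha01|
    exact: room|exact: norm_dualityB_le1].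
have -> : D (open_add s x) h = D s h.
  apply: duality_fun_local => z zh; rewrite /open_add ifN//.
  by apply: contraNneq xh => <-.
by rewrite subrr mulr0 normr0 mul0r.
Qed.

(** Unlike bulk jumps, reservoir edges match one by one; symmetry of [p] only aligns the exit and
    entry rates. *)
Let reservoir_sum s h e : exit_term s h e + entry_term s h e = absorb_term s h e.
Proof.
case: e => x y; rewrite /exit_term /entry_term /absorb_term (pC (val y)).
pose c := p (val x) (val y) / m%:R * sink_factor alpha h *
  prod_except x x (bulk_weights R s h).
pose w := site_weight R m.
have DE : D s h = sink_factor alpha h *
    (w (s x) (h.1 x) * prod_except x x (bulk_weights R s h)).
  exact: duality_fun_site.
have entryE : p (val x) (val y) * alpha y * ((m - s x)%:R / m%:R) *
    (D (open_add s x) h - D s h) =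
    c * (alpha y * (m%:R - (s x)%:R) * (w (s x).+1 (h.1 x) - w (s x) (h.1 x))).
  rewrite natrB//; have [sx|] := ltnP (s x) m; last first.
    move=> ms; have -> : s x = m :> nat by apply/eqP; rewrite eqn_leq ms ord_le.
    by rewrite subrr mul0r !mulr0 !mul0r mulr0.
  by rewrite duality_open_add// DE /c -/w; field.
rewrite entryE duality_open_remove duality_sink_absorb DE -/w.
have E := reservoir_identity (alpha y) (ord_le (s x)) (ord_le (h.1 x)).
apply: etrans (etrans (congr1 ( *%R c) E) _); last by rewrite -/w /c; field.
by rewrite -/w /c; field.
Qed.

Theorem generator_duality s h :
  open_generator p alpha (D ^~ h) s = sink_generator p (D s) h.
Proof.
rewrite /open_generator /sink_generator -addrA; congr (_ + _).
  apply: (@rsum_symmetrized _ _ (open_term s h) (sink_term s h)).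
  - exact: summable_open_term.
  - exact: summable_sink_term.
  - exact: exchange_sym.
rewrite -(@rsumD _ _ (exit_term s h) (entry_term s h)).
- by congr rsum; apply/funext => e; rewrite reservoir_sum.
- exact: summable_exit_term.
- exact: summable_entry_term.
Qed.

End GeneratorIdentity.

(** * Finite approximations of the sink generator *)

Lemma rated_jumps_cat (R : realType) (T : choiceType) (C : set T) (K K' : R)
    (J J' : seq (R * T)) :
  rated_jumps C K J -> rated_jumps C K' J' -> rated_jumps C (K + K') (J ++ J').
Proof.
move=> [CJ JK] [CJ' JK']; split; last by rewrite big_cat lerD.
by move=> j; rewrite mem_cat => /orP[/CJ|/CJ'].
Qed.

Lemma jump_part_cat (R : realType) (T : Type) (J J' : seq (R * T)) g y :
  jump_part (J ++ J') g y = jump_part J g y + jump_part J' g y.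
Proof. by rewrite /jump_part big_cat. Qed.

Lemma rsum_jump_approx (R : realType) (I T : choiceType) (c : I -> R)
    (tr : I -> T) (y : T) (C : set T) (M e : R) :
  (forall i, 0 <= c i) -> (forall r, uniq r -> \sum_(i <- r) c i <= M) ->
  (forall i, c i != 0 -> C (tr i)) -> 0 < e ->
  exists J, rated_jumps C M J /\ forall g, (forall z, `|g z| <= 1) ->
    `|rsum (fun i => c i * (g (tr i) - g y)) - jump_part J g y| <= e.
Proof.
move=> c0 cM cC e0.
(* The factor 2 bounds the difference of two values of a test function bounded by 1. *)
have fc : finite_nnsum (fun i => c i * 2).
  apply: (@finite_nnsum_le _ _ _ (M * 2)) => r ur.
  by rewrite -mulr_suml ler_wpM2r// cM.
have c20 i : 0 <= c i * 2 by rewrite mulr_ge0.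
have [r [ur rF]] := rsum_approx c20 fc e0.
(* Moves of rate 0 are dropped, since their targets may be meaningless and lie outside [C]. *)
exists [seq (c i, tr i) | i <- r & c i != 0]; split; [split|].
- move=> j /mapP[i]; rewrite mem_filter => /andP[ci _] ->.
  by split; [exact: c0|exact: cC].
- by rewrite big_map; apply: cM; exact: filter_uniq.
move=> g g1.
have -> : jump_part [seq (c i, tr i) | i <- r & c i != 0] g y =
    \sum_(i <- r) c i * (g (tr i) - g y).
  rewrite /jump_part big_map big_filter big_mkcond; apply: eq_bigr => i _ /=.
  by case: eqP => [->|//]; rewrite mul0r.
apply: rF => i; rewrite normrM ger0_norm// ler_wpM2l//.
by rewrite (le_trans (ler_normB _ _))// (_ : 2 = 1 + 1)// lerD.
Qed.

Section SinkJumps.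
Variables (R : realType) (G : countType) (p : G -> G -> R) (B : {pred G}).
Variables (m : nat).
Hypothesis p_stoch : symmetric_stochastic p.
Hypothesis m0 : (0 < m)%N.
Implicit Types (h : sink_config B m).

Let p0 x y : 0 <= p x y. Proof. by case: p_stoch. Qed.

(** Only bulk particles are counted, as absorbed ones do not affect the rates. Duplicate-free lists
    replace a sum over the possibly infinite bulk. *)
Definition at_most_particles (N : nat) : set (sink_config B m) :=
  fun h => forall r, uniq r -> (\sum_(x <- r) h.1 x <= N)%N.

Lemma finitely_many_particles h : exists N, at_most_particles N h.
Proof.
exists (size (finsupp h.1) * m)%N => r ur.
rewrite (bigID (mem (finsupp h.1)))/= [X in (_ + X)%N]big1 ?addn0; last first.
  by move=> x; rewrite memNfinsupp => /eqP ->.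
apply: (@leq_trans (\sum_(x <- r | x \in finsupp h.1) m)).
  by apply: leq_sum => x _; rewrite -ltnS.
rewrite -big_filter big_const_seq count_predT iter_addn_0 mulnC leq_mul2r.
apply/orP; right.
rewrite uniq_leq_size ?filter_uniq// => z.
by rewrite mem_filter => /andP[].
Qed.

Lemma at_most_particles_remove N h x : at_most_particles N h ->
  at_most_particles N (sink_remove h x).
Proof.
move=> hN r ur; apply: leq_trans (hN r ur); apply: leq_sum => z _.
rewrite /sink_remove/= fsfun_withE; case: eqP => // ->.
by rewrite inord_pred leq_pred.
Qed.

Lemma at_most_particles_exchange N h x x' : (0 < h.1 x)%N -> (h.1 x' < m)%N ->
  at_most_particles N h -> at_most_particles N (sink_add (sink_remove h x) x').
Proof.
move=> hx hx' hN; have [<-|xx'] := eqVneq x x'.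
  by rewrite sink_exchange_id.
set h' := sink_add _ _.
(* The additive form avoids truncated subtraction. *)
have h'E z : (h'.1 z + (z == x) = h.1 z + (z == x'))%N.
  rewrite /h' /sink_add /sink_remove/= !fsfun_withE.
  have [->|zx'] := eqVneq z x'.
    by rewrite eq_sym (negPf xx') inordK// addn1 addn0.
  have [->|zx] := eqVneq z x; last by [].
  by rewrite inord_pred addn1 prednK// addn0.
(* Lists containing x suffice: enlarging the list only increases the sum, and
   on such a list the particle lost at x pays for the one gained at x'. *)
suff main r : uniq r -> x \in r -> (\sum_(z <- r) h'.1 z <= N)%N.
  move=> r ur; have [xr|xr] := boolP (x \in r); first exact: main.
  apply: (@leq_trans (\sum_(z <- x :: r) h'.1 z)).
    by rewrite big_cons leq_addl.
  by apply: main; rewrite ?mem_head//= xr.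
move=> ur xr; have := hN r ur.
have : (\sum_(z <- r) h'.1 z + \sum_(z <- r) (z == x) =
    \sum_(z <- r) h.1 z + \sum_(z <- r) (z == x'))%N.
  by rewrite -!big_split; apply: eq_bigr => z _; exact: h'E.
have count1 w : (\sum_(z <- r) (z == w) = (w \in r))%N.
  by rewrite -big_mkcond sum1_count count_uniq_mem.
rewrite !count1 xr => E le_hN.
have := leq_b1 (x' \in r); move: E le_hN.
move: (\sum_(z <- r) _)%N (\sum_(z <- r) _)%N => a b.
(* Here [true] is read as 1, the number of occurrences of [x] in [r]. *)
by move=> E bN b1; rewrite -(leq_add2r true) E leq_add.
Qed.

Let bulk_rate h (e : bulk B * bulk B) : R :=
  p (val e.1) (val e.2) * ((h.1 e.1)%:R / m%:R) * ((m - h.1 e.2)%:R / m%:R).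

Let sink_rate h (e : bulk B * bdry B) : R :=
  p (val e.1) (val e.2) * ((h.1 e.1)%:R / m%:R).

Let fill_sum N h : at_most_particles N h -> forall r, uniq r ->
  \sum_(x <- r) ((h.1 x)%:R / m%:R : R) <= N%:R.
Proof.
move=> hN r ur; rewrite -mulr_suml -natr_sum.
apply: (@le_trans _ _ ((\sum_(x <- r) h.1 x)%N%:R : R)).
  by rewrite ler_piMr// invf_le1 ?ler1n ?ltr0n.
by rewrite ler_nat hN.
Qed.

Let sink_rate_sum N h : at_most_particles N h -> forall r, uniq r ->
  \sum_(e <- r) sink_rate h e <= N%:R.
Proof.
move=> hN r ur; rewrite /sink_rate; under eq_bigr do rewrite mulrC.
apply: (@sum_prod_le _ _ _ (fun x => (h.1 x)%:R / m%:R)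
  (fun x y => p (val x) (val y))) ur.
- by move=> x /=; rewrite divr_ge0.
- by move=> x y; exact: p0.
- by move=> x l; apply: sum_rates_le1 => //; exact: val_inj.
- exact: fill_sum.
Qed.

Let bulk_rate_sum N h : at_most_particles N h -> forall r, uniq r ->
  \sum_(e <- r) bulk_rate h e <= N%:R.
Proof.
move=> hN r ur.
apply: (@le_trans _ _
    (\sum_(e <- r) (h.1 e.1)%:R / m%:R * p (val e.1) (val e.2))).
  apply: ler_sum => e _; rewrite /bulk_rate (mulrC (p _ _)).
  rewrite ler_piMr ?mulr_ge0 ?divr_ge0 ?p0//.
  by rewrite ler_pdivrMr ?ltr0n// mul1r ler_nat leq_subr.
apply: (@sum_prod_le _ _ _ (fun x => (h.1 x)%:R / m%:R)
  (fun x y => p (val x) (val y))) ur.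
- by move=> x /=; rewrite divr_ge0.
- by move=> x y; exact: p0.
- by move=> x l; apply: sum_rates_le1 => //; exact: val_inj.
- exact: fill_sum.
Qed.

(** Each particle attempts bulk jumps at total rate at most 1 and absorptions at total rate at most
    1, whence [N + N]. *)
Lemma sink_generator_approximable N :
  jump_approximable (at_most_particles N) (N%:R + N%:R)
    (@sink_generator R G p B m).
Proof.
move=> h e hN e0; have e2 : 0 < e / 2 by rewrite divr_gt0.
have [|||J1 [CJ1 LJ1]] := @rsum_jump_approx R _ _ (bulk_rate h)
  (fun e => sink_add (sink_remove h e.1) e.2) h (at_most_particles N) N%:R _
  _ _ _ e2.
- by move=> i; rewrite /bulk_rate !mulr_ge0 ?divr_ge0 ?p0.
- exact: bulk_rate_sum.
(* A nonzero rate means that [x] is occupied and [x'] is not full, exactly what keeps the target in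
   the class. *)
- move=> [x x']; rewrite /bulk_rate/= !mulf_eq0 !negb_or -!andbA !pnatr_eq0.
  move=> /and5P[_ hx _ hx' _]; apply: at_most_particles_exchange => //.
    by rewrite lt0n.
  by rewrite -subn_gt0 lt0n.
have [|||J2 [CJ2 LJ2]] := @rsum_jump_approx R _ _ (sink_rate h)
  (fun e => sink_absorb (sink_remove h e.1) e.2) h (at_most_particles N) N%:R _
  _ _ _ e2.
- by move=> i; rewrite /sink_rate !mulr_ge0 ?divr_ge0 ?p0.
- exact: sink_rate_sum.
- by move=> [x y] _ r ur; exact: (at_most_particles_remove x hN ur).
exists (J1 ++ J2); split; first exact: rated_jumps_cat.
move=> g g1; rewrite jump_part_cat /sink_generator.
have := LJ1 g g1; have := LJ2 g g1; rewrite /bulk_rate /sink_rate.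
have -> : rsum (fun e : bulk B * bulk B => let: (x, x') := e in
    p (val x) (val x') * ((h.1 x)%:R / m%:R) * ((m - h.1 x')%:R / m%:R) *
    (g (sink_add (sink_remove h x) x') - g h)) =
  rsum (fun e : bulk B * bulk B => bulk_rate h e *
    (g (sink_add (sink_remove h e.1) e.2) - g h)).
  by congr rsum; apply/funext => -[].
have -> : rsum (fun e : bulk B * bdry B => let: (x, y) := e in
    p (val x) (val y) * ((h.1 x)%:R / m%:R) *
    (g (sink_absorb (sink_remove h x) y) - g h)) =
  rsum (fun e : bulk B * bdry B => sink_rate h e *
    (g (sink_absorb (sink_remove h e.1) e.2) - g h)).
  by congr rsum; apply/funext => -[].
rewrite /bulk_rate /sink_rate.
set a := rsum _; set b := rsum _ => bJ aJ.
rewrite opprD addrACA (le_trans (ler_normD _ _))// (splitr e) lerD//.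
Qed.

End SinkJumps.

(** * Duality of the two processes *)

(** A coordinate has finitely many values, so the function is a finite combination of indicators of
    generating events. *)
Lemma measurable_site (R : realType) (G : countType) (B : {pred G}) (m : nat)
    (x : bulk B) (f : 'I_m.+1 -> R) :
  measurable_fun setT (fun s : open_space B m => f (s x)).
Proof.
pose ev (k : 'I_m.+1) : set (open_space B m) := [set s | s x = k].
have -> : (fun s : open_space B m => f (s x)) =
    (fun s => \sum_(k < m.+1) f k * \1_(ev k) s).
  apply/funext => s; rewrite (bigD1 (s x))//= big1 => [|k ks].
    by rewrite indicE mem_set// mulr1 addr0.
  rewrite indicE memNset ?mulr0// => /esym sk; by rewrite sk eqxx in ks.
apply: measurable_sum => k; apply: measurable_funM => //.
by apply: measurable_indic; apply: sub_sigma_algebra; exists x, k.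
Qed.

Lemma measurable_duality_fun (R : realType) (G : countType) (B : {pred G})
    (m : nat) (alpha : bdry B -> R) (h : sink_config B m) :
  measurable_fun setT (fun s : open_space B m => duality_fun alpha s h).
Proof.
have -> : (fun s : open_space B m => duality_fun alpha s h) = (fun s =>
    sink_factor alpha h * \prod_(x <- finsupp h.1) bulk_weights R s h x).
  apply/funext => s; rewrite duality_funE (fsbigTE (finsupp h.1))// => x.
  by rewrite memNfinsupp /bulk_weights => /eqP ->; rewrite site_weight0.
apply: measurable_funM => //; apply: measurable_prod => x _.
exact: measurable_site (fun k : 'I_m.+1 => site_weight R m k (h.1 x)).
Qed.

Lemma measurable_sink_space (G : countType) (B : {pred G}) (m : nat)
  (U : set (sink_space B m)) : measurable U.
Proof. exact: sub_sigma_algebra. Qed.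

Local Close Scope classical_set_scope.

Theorem theorem4p11 (R : realType) (G : countType) (p : G -> G -> R)
    (B : {pred G}) (m : nat) (alpha : bdry B -> R)
    (dO dO' : measure_display)
    (Omega : measurableType dO) (Omega' : measurableType dO')
    (P : open_space B m -> probability Omega R)
    (s : R -> Omega -> open_space B m)
    (P' : sink_space B m -> probability Omega' R)
    (s' : R -> Omega' -> sink_space B m) :
  symmetric_stochastic p ->
  (0 < m)%N ->
  (forall y, 0 <= alpha y <= 1) ->
  is_open_SEP p alpha P s ->
  is_sink_SEP p P' s' ->
  dual_wrt P s P' s' (duality_fun alpha).
Proof.
move=> p_stoch m0 alpha01 [Ps generator_s] [P's' generator_s'] x y t t0.
have D01 (a : open_config B m) b : 0 <= duality_fun alpha a b <= 1.
  exact: duality_fun_ge0_le1.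
have normD (a : open_config B m) b : `|duality_fun alpha a b| <= 1.
  by case/andP: (D01 a b) => ? ?; rewrite ger0_norm.
(* The duality compares extended real expectations, while [semigroup] is their real part;
   integrability bridges the two. *)
have expE dT (T : measurableType dT) (Q : probability T R) (f : T -> R) :
    Q.-integrable setT (EFin \o f) ->
    ('E_Q[f] = (fine 'E_Q[f])%:E)%E.
  by move=> intf; rewrite fineK// unlock; apply: integrable_fin_num.
(* The dual starting point fixes the invariant class on which the uniqueness argument runs. *)
have [N yN] := finitely_many_particles y.
rewrite expE; last first.
  apply: (markov_integrable Ps x t0
    (f := fun a => duality_fun alpha a y) (M := 1)) => //.
  exact: measurable_duality_fun.
rewrite [RHS]expE; last first.
  apply: (markov_integrable P's' y t0 (f := duality_fun alpha x)
    (M := 1)) => //.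
  by move=> _ U _; exact: measurable_sink_space.
congr EFin.
apply: (semigroup_duality Ps P's' (@measurable_sink_space _ _ _)
  (sink_generator_approximable p_stoch m0 (N := N)) _ D01 _ _ x yN t0) => //.
- by move=> b; exact: measurable_duality_fun.
(* The defining property of the open process is uniform in the configuration; [generator_duality]
   then rewrites its generator as the sink generator. *)
- move=> b e _ e0.
  have cyl : cylinder (duality_fun alpha ^~ b).
    exists (finsupp b.1) => a a' aa'; exact: duality_fun_local.
  have := generator_s _ cyl e e0.
  apply: filterS => h Hh a; rewrite -generator_duality//; exact: Hh.
Qed.
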